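(* For every theory $T$, the theories $\mathsf{AC}_{\le 2}(T)+\mathsf{NU}$ and $\mathsf{AS}(T)$ are mutually forcing-interpretable: each forcing-interprets the other.
   Context: All theories are first-order with equality in a finite relational signature; many-sorted theories are identified with one-sorted theories via unary sort predicates. Interpretations are relative interpretations, possibly multi-dimensional, with parameters and definable equality. $\mathsf{AS}(T)$ is the extension of $T$ by a fresh binary predicate $\in$ with axioms $\exists x\forall y\,\neg y\in x$ and $\forall x,y\,\exists z\forall w(w\in z\leftrightarrow(w\in x\lor w=y))$. $\mathsf{AC}_{\le n}(T)$ is the $(n+1)$-sorted theory with sorts $\mathfrak o,\mathfrak c_1,\dots,\mathfrak c_n$, predicates of $T$ on $\mathfrak o$ and predicates $\langle x_1^{\mathfrak o},\dots,x_k^{\mathfrak o}\rangle\in X^{\mathfrak c_k}$ ($1\le k\le n$), with axioms: the axioms of $T$ relativized to $\mathfrak o$; for each $k\le n$, $\exists X^{\mathfrak c_k}\forall x_1,\dots,x_k\,\neg\langle x_1,\dots,x_k\rangle\in X$; and for each $k\le n$, $\forall X^{\mathfrak c_k},x_1,\dots,x_k\exists Y^{\mathfrak c_k}\forall y_1,\dots,y_k(\langle \vec y\rangle\in Y\leftrightarrow(\langle\vec y\rangle\in X\lor\bigwedge_{1\le i\le k}y_i=x_i))$. $\mathsf{NU}$ is the axiom $\neg\exists X^{\mathfrak c_1}\forall x^{\mathfrak o}\,x\in X$. Forcing-interpretation: for a theory $U$, $\mathsf{KM}(U)$ is the two-sorted theory with sorts $\mathfrak w$ (worlds) and $\mathfrak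 d$ (elements), a binary predicate $p\preceq q$ on worlds, a predicate $D(p,x)$, and for each $k$-ary predicate $R$ of $U$ a predicate $R^\star(p,x_1,\dots,x_k)$. Forcing is defined by: $p\Vdash R(\vec x)$ iff $\forall q\preceq p\,\exists r\preceq q\,R^\star(r,\vec x)$; $p\Vdash\varphi\land\psi$ iff $p\Vdash\varphi$ and $p\Vdash\psi$; $p\Vdash\neg\varphi$ iff $\forall q\preceq p\,\neg(q\Vdash\varphi)$; $p\Vdash\forall y\varphi$ iff $\forall q\preceq p\,\forall y(D(q,y)\to q\Vdash\varphi)$. Axioms of $\mathsf{KM}(U)$: $\preceq$ is reflexive and transitive; every $D_p=\{x: D(p,x)\}$ is nonempty; $q\preceq p$ implies $D_p\subseteq D_q$; $R^\star(p,\vec x)$ implies all $x_i\in D_p$; $q\preceq p$ and $R^\star(p,\vec x)$ imply $R^\star(q,\vec x)$; and $\forall p\,(p\Vdash\varphi)$ for every axiom $\varphi$ of $U$. A theory $T$ forcing-interprets $U$ if $T$ interprets $\mathsf{KM}(U)$. *)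

(* Defs.v *)
From mathcomp Require Import all_boot.
Set Implicit Arguments.
Unset Strict Implicit.
Unset Printing Implicit Defensive.

(** * First-order logic with equality over finite relational signatures *)

Record signature := Signature { sym : finType; ar : sym -> nat }.

(* [form L V]: formulas whose free variables are named by elements of [V].
   [All] binds the variable [None]; the variables of the context become
   [Some v].  Sentences are formulas over [void].  The other connectives are
   the usual classical abbreviations. *)
Inductive form (L : signature) (V : Type) : Type :=
| Rel (R : sym L) of (ar R).-tuple V
| Eq of V & V
| And of form L V & form L V
| Not of form L V
| All of form L (option V).

Arguments Rel {L V} R _.
Arguments Eq {L V} _ _.

Notation sentence L := (form L void).
Notation theory L := (form L void -> Prop).

(* There are no function symbols, so renaming is substitution of terms. *)
Fixpoint ren {L : signature} {V W : Type} (f : V -> W) (phi : form L V) :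
    form L W :=
  match phi with
  | Rel R v => Rel R (map_tuple f v)
  | Eq x y => Eq (f x) (f y)
  | And a b => And (ren f a) (ren f b)
  | Not a => Not (ren f a)
  | All a => All (ren (omap f) a)
  end.

Definition inst {L : signature} {V : Type} (phi : form L (option V)) (t : V) :
    form L V := ren (fun v => odflt t v) phi.

Section Connectives.
Context {L : signature} {V : Type}.
Implicit Types a b : form L V.
Definition Imp a b : form L V := Not (And a (Not b)).
Definition Or a b : form L V := Not (And (Not a) (Not b)).
Definition Iff a b : form L V := And (Imp a b) (Imp b a).
Definition Ex (a : form L (option V)) : form L V := Not (All (Not a)).
Definition Top : form L V := All (Eq None None).
Definition Conj (s : seq (form L V)) : form L V := foldr (@And L V) Top s.
Definition Disj (s : seq (form L V)) : form L V := Not (Conj (map (@Not L V) s)).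
Definition EqT n (x y : n.-tuple V) : form L V :=
  Conj [seq Eq p.1 p.2 | p <- zip x y].
End Connectives.

(* Blocks of [n] quantifiers: [ext V n] is [V] with [n] new variables, which
   [bvars] lists from the innermost to the outermost binder. *)
Fixpoint ext (V : Type) (n : nat) : Type :=
  if n is n'.+1 then option (ext V n') else V.

Fixpoint wk {V : Type} (n : nat) (v : V) : ext V n :=
  if n is n'.+1 then Some (wk n' v) else v.

Fixpoint bvars (V : Type) (n : nat) : n.-tuple (ext V n) :=
  if n is n'.+1 then cons_tuple None (map_tuple Some (bvars V n'))
  else nil_tuple V.
Arguments bvars {V} n.

Fixpoint Alls {L : signature} {V : Type} (n : nat) :
    form L (ext V n) -> form L V :=
  if n is n'.+1 then fun a => Alls (All a) else fun a => a.

Definition Exs {L : signature} {V : Type} (n : nat) (a : form L (ext V n)) :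
    form L V := Not (Alls (Not a)).

(* de Bruijn indices *)
Notation v0 := (None) (only parsing).
Notation v1 := (Some None) (only parsing).
Notation v2 := (Some (Some None)) (only parsing).
Notation v3 := (Some (Some (Some None))) (only parsing).

Definition addh {L : signature} {V : Type} (G : form L V -> Prop)
  (a : form L V) : form L V -> Prop := fun b => G b \/ b = a.

Definition lifth {L : signature} {V : Type} (G : form L V -> Prop) :
  form L (option V) -> Prop := fun b => exists2 a, G a & b = ren Some a.

(* Classical natural deduction.  Since a context [V] may be empty, [AllE]
   alone would not give the usual convention that structures are nonempty:
   this is the role of [Fresh]. *)
Inductive prv {L : signature} :
    forall V : Type, (form L V -> Prop) -> form L V -> Prop :=
| Ax V (G : form L V -> Prop) a : G a -> prv G a
| AndI V (G : form L V -> Prop) a b : prv G a -> prv G b -> prv G (And a b)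
| AndE1 V (G : form L V -> Prop) a b : prv G (And a b) -> prv G a
| AndE2 V (G : form L V -> Prop) a b : prv G (And a b) -> prv G b
| NotI V (G : form L V -> Prop) a b :
    prv (addh G a) b -> prv (addh G a) (Not b) -> prv G (Not a)
| Raa V (G : form L V -> Prop) a b :
    prv (addh G (Not a)) b -> prv (addh G (Not a)) (Not b) -> prv G a
| AllI V (G : form L V -> Prop) a : prv (lifth G) a -> prv G (All a)
| AllE V (G : form L V -> Prop) a t : prv G (All a) -> prv G (inst a t)
| EqI V (G : form L V -> Prop) t : prv G (Eq t t)
| EqE V (G : form L V -> Prop) a s t :
    prv G (Eq s t) -> prv G (inst a s) -> prv G (inst a t)
| Fresh V (G : form L V -> Prop) a : prv (lifth G) (ren Some a) -> prv G a.

Definition plus {L : signature} (T : theory L) (a : sentence L) : theory L :=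
  fun b => T b \/ b = a.

Inductive eq_axiom (L : signature) : theory L :=
| eq_refl_ax : eq_axiom (All (Eq v0 v0))
| eq_sym_ax : eq_axiom (All (All (Imp (Eq v1 v0) (Eq v0 v1))))
| eq_trans_ax :
    eq_axiom (All (All (All (Imp (And (Eq v2 v1) (Eq v1 v0)) (Eq v2 v0)))))
| eq_congr_ax (R : sym L) :
    eq_axiom
      (Alls (n := ar R) (Alls (n := ar R)
        (let x := map_tuple (wk (ar R)) (bvars (ar R)) in
         let y := bvars (ar R) in
         Imp (And (EqT x y) (Rel R x)) (Rel R y)))).

(** * Interpretations *)

(* Relative, multi-dimensional translations with parameters and definable
   equality. *)
Record translation (L K : signature) := Translation {
  dim : nat;
  npar : nat;
  parF : form K 'I_npar;
  domF : form K ('I_dim + 'I_npar)%type;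
  eqF : form K ('I_2 * 'I_dim + 'I_npar)%type;
  relF : forall R : sym L, form K ('I_(ar R) * 'I_dim + 'I_npar)%type
}.

Section Translation.
Context {L K : signature} (I : translation L K).

Definition par_at {W : Type} (z : (npar I).-tuple W) : form K W :=
  ren (tnth z) (parF I).

Definition dom_at {W : Type} (x : (dim I).-tuple W) (z : (npar I).-tuple W) :
    form K W :=
  ren (fun s => match s with inl c => tnth x c | inr j => tnth z j end)
    (domF I).

Definition env_at {W : Type} n (x : n.-tuple ((dim I).-tuple W))
    (z : (npar I).-tuple W) (s : 'I_n * 'I_(dim I) + 'I_(npar I)) : W :=
  match s with
  | inl (i, c) => tnth (tnth x i) c
  | inr j => tnth z j
  end.

(* Translation of [phi] when its variables stand for the blocks [e] and the
   parameters are [z]. *)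
Fixpoint tr {V : Type} (phi : form L V) :
    forall W : Type, (V -> (dim I).-tuple W) -> (npar I).-tuple W -> form K W :=
  match phi with
  | Rel R v => fun W e z => ren (env_at (map_tuple e v) z) (relF I R)
  | Eq x y => fun W e z => ren (env_at [tuple e x; e y] z) (eqF I)
  | And a b => fun W e z => And (tr a e z) (tr b e z)
  | Not a => fun W e z => Not (tr a e z)
  | All a => fun W e z =>
      let z' := map_tuple (wk (dim I)) z in
      Alls (n := dim I)
        (Imp (dom_at (bvars (dim I)) z')
          (tr a (fun o => if o is Some v then map_tuple (wk (dim I)) (e v)
                          else bvars (dim I)) z'))
  end.

Definition tr_sentence {W : Type} (phi : sentence L) (z : (npar I).-tuple W) :
    form K W := tr phi (fun v => of_void _ v) z.
End Translation.

Arguments tr {L K} I {V} phi {W}.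
Arguments tr_sentence {L K} I {W}.

(* As equality may be translated by any formula and the domain is given by a
   formula, the equality axioms and nonemptiness are to be verified too. *)
Inductive interp_axiom (L : signature) (U : theory L) : theory L :=
| interp_ax phi of U phi : interp_axiom U phi
| interp_eq phi of eq_axiom phi : interp_axiom U phi
| interp_nonempty : interp_axiom U (Ex Top).

Definition interprets {K L : signature} (T : theory K) (U : theory L) : Prop :=
  exists I : translation L K,
  [/\ 0 < dim I,
      prv T (Exs (n := npar I) (par_at (bvars (npar I)))) &
      forall phi, interp_axiom U phi ->
        prv T (Alls (n := npar I)
          (Imp (par_at (bvars (npar I))) (tr_sentence I phi (bvars (npar I)))))].

(** * Many-sorted theories as one-sorted ones *)

Record msignature := MSignature {
  srt : finType;
  msym : finType;
  mar : msym -> nat;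
  margs : forall R : msym, (mar R).-tuple srt
}.

Definition one_sorted (M : msignature) : signature :=
  @Signature (srt M + msym M)%type
    (fun s => match s with inl _ => 1 | inr R => mar R end).

Section Sorted.
Context {M : msignature}.

Definition Srt {V : Type} (s : srt M) (x : V) : form (one_sorted M) V :=
  @Rel (one_sorted M) V (inl s) [tuple x].

Definition MRel {V : Type} (R : msym M) (x : (mar R).-tuple V) :
  form (one_sorted M) V := @Rel (one_sorted M) V (inr R) x.

Definition AllS {V : Type} (s : srt M) (a : form (one_sorted M) (option V)) :
  form (one_sorted M) V := All (Imp (Srt s v0) a).

Definition ExS {V : Type} (s : srt M) (a : form (one_sorted M) (option V)) :
  form (one_sorted M) V := Ex (And (Srt s v0) a).

Fixpoint AllsS {V : Type} (s : srt M) (n : nat) :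
    form (one_sorted M) (ext V n) -> form (one_sorted M) V :=
  if n is n'.+1 then fun a => AllsS s (AllS s a) else fun a => a.

Inductive sort_axiom : theory (one_sorted M) :=
| sort_nonempty (s : srt M) : sort_axiom (Ex (Srt s v0))
| sort_cover : sort_axiom (All (Disj [seq Srt s v0 | s <- enum (srt M)]))
| sort_disjoint (s s' : srt M) of s != s' :
    sort_axiom (All (Not (And (Srt s v0) (Srt s' v0))))
| sort_typing (R : msym M) :
    sort_axiom (Alls (n := mar R)
      (Imp (MRel (bvars (mar R)))
        (Conj [seq Srt p.1 p.2 | p <- zip (margs R) (bvars (mar R))]))).
End Sorted.

Arguments AllsS {M V} s n _.
Arguments MRel {M V} R _.
Arguments sort_axiom M _ : clear implicits.

(** * Adjunctive sets *)

Definition AS_sig (L : signature) : signature :=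
  @Signature (option (sym L)) (fun o => if o is Some R then ar R else 2).

Definition In {L : signature} {V : Type} (x y : V) : form (AS_sig L) V :=
  @Rel (AS_sig L) V None [tuple x; y].

Fixpoint AS_emb {L : signature} {V : Type} (phi : form L V) :
    form (AS_sig L) V :=
  match phi with
  | Rel R v => @Rel (AS_sig L) _ (Some R) v
  | Eq x y => Eq x y
  | And a b => And (AS_emb a) (AS_emb b)
  | Not a => Not (AS_emb a)
  | All a => All (AS_emb a)
  end.

Inductive AS {L : signature} (T : theory L) : theory (AS_sig L) :=
| AS_base phi of T phi : AS T (AS_emb phi)
| AS_empty : AS T (Ex (All (Not (In v0 v1))))
| AS_adj :
    AS T (All (All (Ex (All (Iff (In v0 v1) (Or (In v0 v3) (Eq v0 v2))))))).

(** * Adjunctive classes *)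

(* Sorts: [None] is the sort of objects and [Some k], [k : 'I_n], is the sort
   of classes of [k.+1]-tuples of objects.  [inr k] is the membership
   predicate of the latter, with the class as first argument. *)
Definition AC_msig (L : signature) (n : nat) : msignature :=
  @MSignature (option 'I_n) (sym L + 'I_n)%type
    (fun s => match s with inl R => ar R | inr k => k.+2 end)
    (fun s => match s with
              | inl R => nseq_tuple (ar R) None
              | inr k => cons_tuple (Some k) (nseq_tuple k.+1 None)
              end).

Definition AC_sig (L : signature) (n : nat) : signature :=
  one_sorted (AC_msig L n).

Section AC.
Context {L : signature} {n : nat}.

Definition obj : srt (AC_msig L n) := None.
Definition cls (k : 'I_n) : srt (AC_msig L n) := Some k.

Definition Mem {V : Type} (k : 'I_n) (x : k.+1.-tuple V) (X : V) :
    form (AC_sig L n) V :=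
  @MRel (AC_msig L n) V (inr k) (cons_tuple X x).

Fixpoint AC_relativize {V : Type} (phi : form L V) : form (AC_sig L n) V :=
  match phi with
  | Rel R v => @MRel (AC_msig L n) _ (inl R) v
  | Eq x y => Eq x y
  | And a b => And (AC_relativize a) (AC_relativize b)
  | Not a => Not (AC_relativize a)
  | All a => AllS obj (AC_relativize a)
  end.

Inductive AC (T : theory L) : theory (AC_sig L n) :=
| AC_sorts phi of sort_axiom (AC_msig L n) phi : AC T phi
| AC_base phi of T phi : AC T (AC_relativize phi)
| AC_empty (k : 'I_n) :
    AC T (ExS (cls k) (AllsS obj k.+1
      (Not (Mem (bvars k.+1) (wk k.+1 None)))))
| AC_adj (k : 'I_n) :
    AC T (AllS (cls k) (AllsS obj k.+1 (ExS (cls k) (AllsS obj k.+1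
      (let X := wk k.+1 (Some (wk k.+1 None)) in
       let x := map_tuple (fun v => wk k.+1 (Some v)) (bvars k.+1) in
       let Y := wk k.+1 None in
       let y := bvars k.+1 in
       Iff (Mem y Y) (Or (Mem y X) (EqT y x))))))).
End AC.

Arguments AC {L} n T _.

Definition NU (L : signature) (n : nat) : sentence (AC_sig L n.+1) :=
  Not (ExS (cls ord0) (AllS obj (Mem (k := ord0) [tuple v0] v1))).
Arguments NU {L n}.

(** * Forcing-interpretations *)

Section KM.
Context {L : signature}.

(* The predicates of [L]; [None] is equality, which is forced like any other
   predicate. *)
Definition pred_ar (R : option (sym L)) : nat := if R is Some R' then ar R' else 2.

(* Sorts: [true] for worlds, [false] for elements.  Predicates: [inl true] is
   the order on worlds, [inl false] is [D], [inr R] is [R^star]. *)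
Definition KM_msig : msignature :=
  @MSignature bool (bool + option (sym L))%type
    (fun s => match s with inl _ => 2 | inr R => (pred_ar R).+1 end)
    (fun s => match s with
              | inl true => [tuple true; true]
              | inl false => [tuple true; false]
              | inr R => cons_tuple true (nseq_tuple (pred_ar R) false)
              end).

Definition KM_sig : signature := one_sorted KM_msig.

Definition world : srt KM_msig := true.
Definition elem : srt KM_msig := false.

Definition Leq {V : Type} (p q : V) : form KM_sig V :=
  @MRel KM_msig V (inl true) [tuple p; q].
Definition InD {V : Type} (p x : V) : form KM_sig V :=
  @MRel KM_msig V (inl false) [tuple p; x].
Definition Star {V : Type} (R : option (sym L)) (p : V)
    (x : (pred_ar R).-tuple V) : form KM_sig V :=
  @MRel KM_msig V (inr R) (cons_tuple p x).

Definition forces_atom {W : Type} (p : W) (R : option (sym L))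
    (x : (pred_ar R).-tuple W) : form KM_sig W :=
  AllS world (Imp (Leq v0 (Some p))
    (ExS world (And (Leq v0 v1)
      (Star v0 (map_tuple (fun v => Some (Some v)) x))))).

(* [forces phi p e]: the world [p] forces [phi], the variables of [phi] being
   replaced according to [e]. *)
Fixpoint forces {V : Type} (phi : form L V) :
    forall W : Type, W -> (V -> W) -> form KM_sig W :=
  match phi with
  | Rel R v => fun W p e => forces_atom p (R := Some R) (map_tuple e v)
  | Eq x y => fun W p e => forces_atom p (R := None) [tuple e x; e y]
  | And a b => fun W p e => And (forces a p e) (forces b p e)
  | Not a => fun W p e =>
      AllS world (Imp (Leq v0 (Some p))
        (Not (forces a (None : option W) (fun v => Some (e v)))))
  | All a => fun W p e =>
      AllS world (Imp (Leq v0 (Some p))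
        (AllS elem (Imp (InD v1 v0)
          (forces a (Some None : option (option W))
            (fun o => if o is Some v then Some (Some (e v)) else None)))))
  end.

(* The equality axioms are among the axioms of every theory. *)
Inductive KM (U : theory L) : theory KM_sig :=
| KM_sorts phi of sort_axiom KM_msig phi : KM U phi
| KM_refl : KM U (AllS world (Leq v0 v0))
| KM_trans :
    KM U (AllS world (AllS world (AllS world
      (Imp (And (Leq v2 v1) (Leq v1 v0)) (Leq v2 v0)))))
| KM_dom_nonempty : KM U (AllS world (ExS elem (InD v1 v0)))
| KM_dom_mono :
    KM U (AllS world (AllS world (Imp (Leq v0 v1)
      (AllS elem (Imp (InD v2 v0) (InD v1 v0))))))
| KM_star_dom (R : option (sym L)) :
    KM U (AllS world (AllsS elem (pred_ar R)
      (let p := wk (pred_ar R) None in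
       let x := bvars (pred_ar R) in
       Imp (Star p x) (Conj [seq InD p v | v <- x]))))
| KM_star_mono (R : option (sym L)) :
    KM U (AllS world (AllS world (AllsS elem (pred_ar R)
      (let p := wk (pred_ar R) (Some None) in
       let q := wk (pred_ar R) None in
       let x := bvars (pred_ar R) in
       Imp (And (Leq q p) (Star p x)) (Star q x)))))
| KM_axiom phi of U phi :
    KM U (AllS world (forces phi None (fun v => of_void _ v)))
| KM_eq_axiom phi of eq_axiom phi :
    KM U (AllS world (forces phi None (fun v => of_void _ v))).
End KM.

Arguments KM_sig L : clear implicits.

Definition forcing_interprets {K L : signature} (T : theory K) (U : theory L) :
    Prop := interprets T (KM U).

(* Main.v *)
(* Provability is reduced to truth in all models by a completeness theorem, so
   that an interpretation of [KM U] in [T] may be given by uniformly defining a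
   Kripke model forcing [U] in every model of [T].

   [AS T] even interprets [AC 2 T + NU], that is, there is a definable Kripke
   model with one world.  Binary classes are sets of Kuratowski pairs.  Only
   those sets [x] count as unary classes for which [{w in x | w notin w}] is a
   set: by Russell's paradox none of them is universal, and they are closed
   under adjunction.

   Conversely, over a model of [AC 2 T + NU] a membership relation on the
   objects is added generically.  A condition [(A, E)] decides the sets coded by
   the members of the unary class [A]: these are the columns of the binary class
   [E].  Coding the adjunction of [y] to [x] by a new [z], which exists by NU,
   requires the class [E + (column x of E) * {z} + (y, z)].  The columns of
   conditions are therefore required to be addible: [F + column * {c}] is a class
   for every class [F] and every [c].  This is again true of the new condition,
   since the new column is an old one plus one point. *)

From mathcomp Require Import all_boot.
From mathcomp.classical Require Import boolp.
Require Import Defs.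

Set Implicit Arguments.
Unset Strict Implicit.
Unset Printing Implicit Defensive.

(** * Renaming *)

Section Renaming.
Context {L : signature}.

Lemma ren_ren {V : Type} (a : form L V) : forall W X (f : V -> W) (g : W -> X),
  ren g (ren f a) = ren (g \o f) a.
Proof.
elim: a => {V} [V R v|V x y|V a IHa b IHb|V a IHa|V a IHa] W X f g //=.
- by congr Rel; apply: val_inj; rewrite /= -map_comp.
- by rewrite IHa IHb.
- by rewrite IHa.
- by rewrite IHa; congr (All (ren _ _)); apply: funext; case.
Qed.

(** Free variables are bounded by a predicate rather than listed, as their type changes under a
    binder; the default [True] exempts the bound variable. *)
Fixpoint allfv {V : Type} (P : V -> Prop) (a : form L V) : Prop :=
  match a with
  | Rel R v => forall i, P (tnth v i)
  | Eq x y => P x /\ P y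
  | And a b => allfv P a /\ allfv P b
  | Not a => allfv P a
  | All a => allfv (oapp P True) a
  end.

Lemma allfv_sub {V : Type} (a : form L V) : forall P Q : V -> Prop,
  (forall v, P v -> Q v) -> allfv P a -> allfv Q a.
Proof.
elim: a => {V} [V R v|V x y|V a IHa b IHb|V a IHa|V a IHa] P Q PQ //=.
- by move=> h i; apply/PQ/h.
- by case=> /PQ ? /PQ.
- by case=> /IHa-/(_ _ PQ) ? /IHb-/(_ _ PQ).
- exact: IHa.
- by apply: IHa; case.
Qed.

Lemma eq_ren_fv {V : Type} (a : form L V) : forall (P : V -> Prop) W (f g : V -> W),
  allfv P a -> (forall v, P v -> f v = g v) -> ren f a = ren g a.
Proof.
elim: a => {V} [V R v|V x y|V a IHa b IHb|V a IHa|V a IHa] P W f g /= Pa fg.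
- congr Rel; apply: eq_from_tnth => i; rewrite !tnth_map; exact/fg/Pa.
- by case: Pa => /fg-> /fg->.
- by case: Pa => /IHa-/(_ _ _ _ fg)-> /IHb-/(_ _ _ _ fg)->.
- by rewrite (IHa _ _ _ _ Pa fg).
- by rewrite (IHa _ _ _ (omap g) Pa) // => -[v /= /fg->|].
Qed.

Lemma allfv_ren {V : Type} (a : form L V) : forall W (f : V -> W) (P : W -> Prop),
  allfv (P \o f) a -> allfv P (ren f a).
Proof.
elim: a => {V} [V R v|V x y|V a IHa b IHb|V a IHa|V a IHa] W f P //=.
- by move=> h i; rewrite tnth_map; apply: h.
- by case=> /IHa ? /IHb.
- exact: IHa.
- by move=> h; apply: IHa; move: h; apply: allfv_sub; case.
Qed.

Lemma allfvT {V : Type} (a : form L V) : allfv (fun=> True) a.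
Proof.
elim: a => {V} //= V a IHa; move: IHa; apply: allfv_sub; by case.
Qed.

Lemma eq_ren {V W : Type} (f g : V -> W) (a : form L V) : f =1 g -> ren f a = ren g a.
Proof. by move=> fg; apply: eq_ren_fv (allfvT a) _. Qed.

Lemma ren_id {V : Type} (f : V -> V) (a : form L V) : f =1 id -> ren f a = a.
Proof.
move=> fid; rewrite (eq_ren _ fid) {fid f}.
elim: a => {V} //= [V R v|V a -> b ->|V a ->|V a IHa] //.
  by congr Rel; apply: val_inj; rewrite /= map_id.
by rewrite -[in RHS]IHa; congr All; apply: eq_ren; case.
Qed.

(** The numbering [e] is arbitrary so that the induction passes under a binder, where the new
    variable gets the harmless number 0. *)
Lemma allfv_bound {V : Type} (a : form L V) : forall e : V -> nat,
  exists m, allfv (fun v => e v < m) a.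
Proof.
elim: a => {V} [V R v|V x y|V a IHa b IHb|V a IHa|V a IHa] e /=.
- by exists (\max_i e (tnth v i)).+1 => i; rewrite ltnS leq_bigmax.
- by exists (maxn (e x) (e y)).+1; rewrite !ltnS leq_maxl leq_maxr.
- have [m am] := IHa e; have [n bn] := IHb e; exists (maxn m n); split.
    by apply: allfv_sub am => v /leq_trans; apply; rewrite leq_maxl.
  by apply: allfv_sub bn => v /leq_trans; apply; rewrite leq_maxr.
- exact: IHa.
- have [m am] := IHa (oapp e 0); exists m.
  by apply: allfv_sub am; case.
Qed.

Lemma ren_inst {V W : Type} (f : V -> W) (a : form L (option V)) t :
  ren f (inst a t) = inst (ren (omap f) a) (f t).
Proof. by rewrite /inst !ren_ren; apply: eq_ren; case. Qed.

Lemma ren_Some {V W : Type} (f : V -> W) (a : form L V) :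
  ren (omap f) (ren Some a) = ren Some (ren f a).
Proof. by rewrite !ren_ren. Qed.

End Renaming.

(** * Completeness *)

Section Derivations.
Context {L : signature}.

(** The renaming need not be injective. Weakening is the case of the identity; other cases turn a
    fresh variable into a bound one, or identify all variables. *)
Lemma prv_ren {V : Type} (G : form L V -> Prop) a : prv G a ->
  forall W (f : V -> W) (G' : form L W -> Prop),
  (forall b, G b -> G' (ren f b)) -> prv G' (ren f a).
Proof.
have addh_ren V' W (f : V' -> W) (H : form L V' -> Prop) H' c :
    (forall b, H b -> H' (ren f b)) ->
    forall b, addh H c b -> addh H' (ren f c) (ren f b).
  by move=> HH b [/HH|->]; [left|right].
have lifth_ren V' W (f : V' -> W) (H : form L V' -> Prop) H' :
    (forall b, H b -> H' (ren f b)) ->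
    forall b, lifth H b -> lifth H' (ren (omap f) b).
  by move=> HH _ [b Hb ->]; exists (ren f b); [exact: HH | exact: ren_Some].
elim=> {V G a}.
- by move=> V G a Ga W f G' GG'; apply/Ax/GG'.
- by move=> V G a b _ IHa _ IHb W f G' GG'; apply: AndI; [exact: IHa|exact: IHb].
- by move=> V G a b _ IH W f G' GG'; apply: AndE1 (IH _ f _ GG').
- by move=> V G a b _ IH W f G' GG'; apply: AndE2 (IH _ f _ GG').
- move=> V G a b _ IH1 _ IH2 W f G' GG'; apply: (@NotI _ _ _ _ (ren f b)).
    exact/IH1/addh_ren.
  exact/(IH2 _ f)/addh_ren.
- move=> V G a b _ IH1 _ IH2 W f G' GG'; apply: (@Raa _ _ _ _ (ren f b)).
    exact/IH1/(addh_ren _ _ _ _ _ (Not a)).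
  exact/(IH2 _ f)/(addh_ren _ _ _ _ _ (Not a)).
- by move=> V G a _ IH W f G' GG'; apply/AllI/IH/lifth_ren.
- by move=> V G a t _ IH W f G' GG'; rewrite ren_inst; apply/AllE/(IH _ f).
- by move=> *; apply: EqI.
- move=> V G a s t _ IH1 _ IH2 W f G' GG'; rewrite ren_inst.
  by apply: EqE (IH1 _ f _ GG') _; rewrite -ren_inst; apply: IH2.
- move=> V G a _ IH W f G' GG'; apply: Fresh; rewrite -ren_Some.
  exact/IH/lifth_ren.
Qed.

Lemma prv_weak {V : Type} (G G' : form L V -> Prop) a :
  (forall b, G b -> G' b) -> prv G a -> prv G' a.
Proof.
move=> GG' /prv_ren-/(_ V id G'); rewrite ren_id //; apply => b.
by rewrite ren_id //; apply: GG'.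
Qed.

Lemma prv_addh {V : Type} (G : form L V -> Prop) a b : prv G b -> prv (addh G a) b.
Proof. by apply: prv_weak => c; left. Qed.

Lemma prv_hyp {V : Type} (G : form L V -> Prop) a : prv (addh G a) a.
Proof. by apply: Ax; right. Qed.

Definition consistent {V : Type} (G : form L V -> Prop) :=
  forall a, prv G a -> prv G (Not a) -> False.

Lemma consistent_addN {V : Type} (G : form L V -> Prop) a :
  ~ prv G a -> consistent (addh G (Not a)).
Proof. by move=> nGa b h1 h2; apply/nGa/Raa; [exact: h1 | exact: h2]. Qed.

Lemma inconsistent_add {V : Type} (G : form L V -> Prop) a :
  ~ consistent (addh G a) -> prv G (Not a).
Proof.
move=> h; apply: contrapT => nGa; apply: h => b h1 h2.
by apply/nGa/NotI; [exact: h1 | exact: h2].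
Qed.

(** The variable [m] is fresh, so a derivation of [inst b m] becomes, after renaming [m] to the
    bound variable, a derivation of [b] from the lifted hypotheses, hence one of [All b]. *)
Lemma consistent_witness (G : form L nat -> Prop) b m :
  (forall c, G c -> allfv (fun v => v < m) c) ->
  allfv (oapp (fun v : nat => is_true (v < m)) True) b ->
  consistent (addh G (Not (All b))) ->
  consistent (addh (addh G (Not (All b))) (Not (inst b m))).
Proof.
move=> Gm bm con; apply: consistent_addN => /prv_ren prb.
pose g j := if j == m then None else Some j.
have gS j : j < m -> g j = Some j by rewrite /g; case: ltngtP.
apply: con (prv_hyp G _); apply: AllI.
have E : ren g (inst b m) = b.
  rewrite ren_ren -[RHS](@ren_id _ _ id) //; apply: eq_ren_fv bm _ => -[j /= /gS|] //=.
  by rewrite /g eqxx.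
move: (prb _ g (lifth (addh G (Not (All b))))); rewrite E; apply=> c Gc; exists c => //.
apply: (@eq_ren_fv _ _ _ (fun v : nat => is_true (v < m))) => //.
by case: Gc => [/Gm|->].
Qed.

End Derivations.

(** * Countability of the set of formulas *)

Section Enumeration.
Context {L : signature}.

(** Formulas are mapped injectively to finite trees labelled by numbers, which form a countable
    type. Under a binder the new variable is numbered 0 and the others are shifted, which keeps the
    numbering injective. *)
Fixpoint code {V : Type} (a : form L V) : (V -> nat) -> GenTree.tree nat :=
  match a with
  | Rel R v => fun e => GenTree.Node 0
      (GenTree.Leaf (enum_rank R : nat) :: [seq GenTree.Leaf (e x) | x <- v])
  | Eq x y => fun e => GenTree.Node 1 [:: GenTree.Leaf (e x); GenTree.Leaf (e y)]
  | And a b => fun e => GenTree.Node 2 [:: code a e; code b e]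
  | Not a => fun e => GenTree.Node 3 [:: code a e]
  | All a => fun e => GenTree.Node 4 [:: code a (oapp (S \o e) 0)]
  end.

Lemma code_inj {V : Type} (a : form L V) : forall b (e : V -> nat), injective e ->
  code a e = code b e -> a = b.
Proof.
elim: a => {V} [V R v|V x y|V a IHa b IHb|V a IHa|V a IHa]
  [R' v'|x' y'|a' b'|a'|a'] e e_inj //=.
- case=> /ord_inj/enum_rank_inj RR'; subst R' => vv'; congr Rel; apply: val_inj.
  by apply: inj_map vv' => s t [/e_inj].
- by case=> /e_inj-> /e_inj->.
- by case=> /IHa-/(_ e_inj)-> /IHb-/(_ e_inj)->.
- by case=> /IHa-/(_ e_inj)->.
- by case=> /IHa-> // [s|] [t|] //= [/e_inj->].
Qed.

Lemma form_enum : exists f : nat -> form L nat, forall a, exists n, f n = a.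
Proof.
pose c (a : form L nat) := pickle (code a id).
(* Numbers that code no formula are sent to the arbitrary value [Eq 0 0]. *)
exists (fun n => if pselect (exists a, c a = n) is left h then sval (cid h)
                 else Eq 0 0) => a.
exists (c a); case: pselect => [h|[]]; last by exists a.
by case: (cid h) => b /= /(pcan_inj pickleK)/code_inj; apply.
Qed.

End Enumeration.

(** * Structures and truth *)

Definition str (L : signature) (M : Type) := forall R : sym L, (ar R).-tuple M -> Prop.

Section Satisfaction.
Context {L : signature} {M : Type} (r : str L M).

Fixpoint sat {V : Type} (a : form L V) : (V -> M) -> Prop :=
  match a with
  | Rel R v => fun e => r (map_tuple e v)
  | Eq x y => fun e => e x = e y
  | And a b => fun e => sat a e /\ sat b e
  | Not a => fun e => ~ sat a e
  | All a => fun e => forall x, sat a (oapp e x)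
  end.

Lemma sat_All {V : Type} (a : form L (option V)) e :
  sat (All a) e <-> forall x, sat a (oapp e x).
Proof. by []. Qed.

End Satisfaction.

Definition models {L} {M : Type} (r : str L M) (T : theory L) :=
  forall a, T a -> sat r a (of_void M).

(** * Henkin's construction of a model *)

Section Henkin.
Context {L : signature} (G0 : form L nat -> Prop).
Hypothesis G0_closed : forall a, G0 a -> allfv (fun=> False) a.
Hypothesis G0_con : consistent G0.

(** The bound leaves fresh variables to serve as Henkin witnesses. *)
Definition good (G : form L nat -> Prop) :=
  consistent G /\ exists m, forall c, G c -> allfv (fun v => v < m) c.

(** A variable [n] beyond all those of [G] and [a] can serve as the counterexample to a negated
    universal formula, by [consistent_witness]. *)
Lemma good_step G a : good G -> exists G', [/\ good G', forall b, G b -> G' b &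
  consistent (addh G a) ->
  G' a /\ forall b, a = Not (All b) -> exists k, G' (Not (inst b k))].
Proof.
move=> gG; have [con|ncon] := pselect (consistent (addh G a)); last first.
  by exists G; split.
case: gG => _ [m Gm].
have [m' am'] := allfv_bound a id.
pose n := maxn m m'.
have Gn c : addh G a c -> allfv (fun v => v < n) c.
  case=> [/Gm|->]; [|move: am']; apply: allfv_sub => v /leq_trans; apply.
    by rewrite leq_maxl.
  by rewrite leq_maxr.
have [[b ab]|nab] := pselect (exists b, a = Not (All b)); last first.
  exists (addh G a); split=> [|b Gb|_]; [|by left|].
    by split=> //; exists n.
  by split=> [|b ab]; [right | case: nab; exists b].
have bn : allfv (oapp (fun v : nat => is_true (v < n)) True) b.
  by have := Gn a (or_intror erefl); rewrite ab.
exists (addh (addh G a) (Not (inst b n))); split=> [|c Gc|_].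
- split.
    rewrite ab; apply: consistent_witness => //; last by rewrite -ab.
    by move=> c Gc; apply: Gn; left.
  have [p pP] := allfv_bound (Not (inst b n)) id.
  exists (maxn n p) => c [/Gn|->]; [|move: pP]; apply: allfv_sub => v /leq_trans; apply.
    by rewrite leq_maxl.
  by rewrite leq_maxr.
- by left; left.
- split; first by left; right.
  by move=> b'; rewrite ab => -[<-]; exists n; right.
Qed.

(** [D] consists of the consequences of the stages of a chain along which every formula is
    considered. A formula inconsistent with its stage is refuted there, so [D] is complete; a
    universal formula outside [D] has the counterexample added with its negation. *)
Lemma henkin_set : exists D : form L nat -> Prop,
  [/\ forall a, G0 a -> D a,
      forall a, D (Not a) <-> ~ D a,
      forall a b, D (And a b) <-> D a /\ D b,
      forall a, D (All a) <-> forall k, D (inst a k) &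
      (forall t, D (Eq t t)) /\
      (forall a s t, D (Eq s t) -> D (inst a s) -> D (inst a t))].
Proof.
have [f fP] := @form_enum L.
have good0 : good G0.
  by split=> //; exists 0 => c /G0_closed; apply: allfv_sub.
have [st stP] : {st : nat -> {G | good G} -> {G | good G} |
    forall n G, (forall b, sval G b -> sval (st n G) b) /\
     (consistent (addh (sval G) (f n)) -> sval (st n G) (f n) /\
      forall b, f n = Not (All b) -> exists k, sval (st n G) (Not (inst b k)))}.
  apply: cid.
  have : forall p : nat * {G | good G}, exists G' : {G | good G},
     (forall b, sval p.2 b -> sval G' b) /\
     (consistent (addh (sval p.2) (f p.1)) -> sval G' (f p.1) /\
      forall b, f p.1 = Not (All b) -> exists k, sval G' (Not (inst b k))).
    by move=> [n [G gG]] /=; have [G' [gG' ? ?]] := good_step (f n) gG; exists (exist _ G' gG').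
  by move=> /choice[st stP]; exists (fun n G => st (n, G)) => n G; apply: (stP (n, G)).
pose G n := iteri n st (exist _ G0 good0).
have GS n b : sval (G n) b -> sval (G n.+1) b by apply: (stP _ _).1.
have Gle m n b : m <= n -> sval (G m) b -> sval (G n) b.
  by move=> /subnK<-; elim: (n - m) => [|k IHk /IHk]; [|exact: GS].
pose D a := exists n, prv (sval (G n)) a.
have Dax n b : sval (G n) b -> D b by move=> h; exists n; apply: Ax.
have D1 a b : (forall H, prv H a -> prv H b) -> D a -> D b.
  by move=> ab [n h]; exists n; apply: ab.
have D2 a b c : (forall H, prv H a -> prv H b -> prv H c) -> D a -> D b -> D c.
  move=> abc [n h] [m h']; exists (maxn n m); apply: abc.
    by apply: prv_weak h => d; apply: Gle; rewrite leq_maxl.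
  by apply: prv_weak h' => d; apply: Gle; rewrite leq_maxr.
have Dcon a : D a -> D (Not a) -> False.
  move=> [n h] [m h']; apply: ((svalP (G (maxn n m))).1 a).
    by apply: prv_weak h => d; apply: Gle; rewrite leq_maxl.
  by apply: prv_weak h' => d; apply: Gle; rewrite leq_maxr.
have Dcomp a : D a \/ D (Not a).
  have [n <-] := fP a.
  have [/(stP n (G n)).2[h _]|h] := pselect (consistent (addh (sval (G n)) (f n))).
    by left; apply: (Dax n.+1).
  by right; exists n; apply: inconsistent_add.
have DN a : D (Not a) <-> ~ D a.
  by split=> [h /Dcon|h]; [apply|case: (Dcomp a)].
exists D; split=> //.
- by move=> a; apply: (Dax 0).
- move=> a b; split=> [h|[]]; last by apply: D2 => H; exact: AndI.
  by split; apply: D1 h => H; [exact: AndE1|exact: AndE2].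
- move=> a; split=> [h k|h]; first by apply: D1 h => H; exact: AllE.
  apply: contrapT => /DN Da; have [n fn] := fP (Not (All a)).
  suff con : consistent (addh (sval (G n)) (f n)).
    have [_ /(_ _ fn)[k hk]] := (stP n (G n)).2 con.
    by apply: (Dcon _ (h k)); apply: (Dax n.+1).
  apply: contrapT => /inconsistent_add; rewrite fn => h'.
  by apply: (Dcon _ Da); exists n.
- split; first by move=> t; exists 0; apply: EqI.
  by move=> a s t; apply: D2 => H; exact: EqE.
Qed.

(** The model is that of the variables modulo the equality which [D] asserts, and truth in it is
    membership in [D]. *)
Lemma henkin_model : exists (M : Type) (r : str L M) (x0 : M),
  forall a, G0 a -> sat r a (fun=> x0).
Proof.
have [D [DG0 DN DA DAll [Deq0 Dsub]]] := henkin_set.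
have Dsym s t : D (Eq s t) -> D (Eq t s).
  by move=> h; have := Dsub (Eq None (Some s)) s t h; apply; apply: Deq0.
have Dtrans s t u : D (Eq s t) -> D (Eq t u) -> D (Eq s u).
  by move=> h h'; apply: (Dsub (Eq (Some s) None) t u h').
have Dcongr (a : form L nat) n (e e' : nat -> nat) :
    (forall i, D (Eq (e i) (e' i))) -> D (ren e a) ->
    D (ren (fun i => if i < n then e' i else e i) a).
  move=> ee' h; elim: n => [|n IHn]; first by rewrite (@eq_ren _ _ _ _ e).
  pose b := ren (fun i => if i == n then None
                          else Some (if i < n then e' i else e i)) a.
  have E t (g : nat -> nat) : g n = t ->
      (forall i, i != n -> g i = if i < n then e' i else e i) ->
      inst b t = ren g a.
    move=> gn gi; rewrite /inst ren_ren; apply: eq_ren => i /=.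
    by have [->|/gi->] := eqVneq i n.
  move: (Dsub b _ _ (ee' n)); rewrite (E (e' n) (fun i => if i < n.+1 then e' i else e i)).
  - rewrite (E (e n) (fun i => if i < n then e' i else e i)) ?ltnn //; exact.
  - by rewrite ltnS leqnn.
  - by move=> i /negPf i_n; rewrite ltnS leq_eqVlt i_n.
(* [xchoose] depends only on the extension of the predicate, so variables equal according to [D] get
   the same representative. The model consists of these representatives. *)
have ex i : exists j, (fun j => `[< D (Eq i j) >]) j by exists i; apply/asboolP.
pose rep i := xchoose (ex i).
have repP i : D (Eq i (rep i)) by apply/asboolP/(xchooseP (ex i)).
have rep_eq i j : D (Eq i j) -> rep i = rep j.
  move=> ij; apply: eq_xchoose => k; apply/asboolP/asboolP => h.
    exact: Dtrans (Dsym _ _ ij) h.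
  exact: Dtrans ij h.
pose M := {i : nat | rep i == i}.
have repM i : rep (rep i) == rep i by rewrite eq_sym; apply/eqP/rep_eq/repP.
pose r : str L M := fun R v => D (Rel R (map_tuple val v)).
pose mk i : M := exist _ (rep i) (repM i).
have truth V (a : form L V) : forall e : V -> M, sat r a e <-> D (ren (val \o e) a).
  elim: a => {V} [V R v|V x y|V a IHa b IHb|V a IHa|V a IHa] e /=.
  - rewrite /r; suff -> : map_tuple val (map_tuple e v) = map_tuple (val \o e) v by [].
    by apply: val_inj; rewrite /= -map_comp.
  - split=> [->|/rep_eq]; first exact: Deq0.
    by rewrite (eqP (valP (e x))) (eqP (valP (e y))) => /val_inj.
  - by rewrite DA IHa IHb.
  - by rewrite DN IHa.
  (* Instances at all variables follow from those at representatives, since [D] is closed under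
     replacing equals. *)
  - rewrite DAll; split=> h k.
      have /IHa := h (mk k); set b := ren _ a.
      have -> : b = inst (ren (omap (val \o e)) a) (rep k).
        by rewrite /b /inst ren_ren; apply: eq_ren; case.
      exact/Dsub/Dsym/repP.
    apply/IHa; have := h (val k); rewrite /inst ren_ren.
    by rewrite (eq_ren (g := val \o oapp e k)) //; case.
(* The value given to the variables is immaterial, the formulas of [G0] being closed. *)
exists M, r, (mk 0) => a G0a; apply/truth.
rewrite (@eq_ren_fv _ _ _ (fun=> False) _ _ id) ?ren_id //; first exact: DG0.
exact: G0_closed.
Qed.

End Henkin.

Lemma sat_ren {L : signature} {M : Type} (r : str L M) {V : Type} (a : form L V) :
  forall W (f : V -> W) (e : W -> M), sat r (ren f a) e <-> sat r a (e \o f).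
Proof.
elim: a => {V} [V R v|V x y|V a IHa b IHb|V a IHa|V a IHa] W f e //=.
- suff -> : map_tuple e (map_tuple f v) = map_tuple (e \o f) v by [].
  by apply: val_inj; rewrite /= -map_comp.
- by rewrite IHa IHb.
- by rewrite IHa.
- have E x : oapp e x \o omap f = oapp (e \o f) x by apply: funext; case.
  by split=> h x; have := h x; rewrite IHa E.
Qed.

Theorem completeness (L : signature) (T : theory L) (a : sentence L) :
  (forall (M : Type) (r : str L M), M -> models r T -> sat r a (of_void M)) ->
  prv T a.
Proof.
move=> Ta; apply: contrapT => /consistent_addN con.
(* Sentences are moved to the variables [nat], which supply the Henkin witnesses. *)
pose G0 b := exists2 c, addh T (Not a) c & b = ren (of_void nat) c.
have closed b : G0 b -> allfv (fun=> False) b.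
  case=> c _ ->; apply: allfv_ren; move: (allfvT c); apply: allfv_sub; by case.
(* A contradiction over [nat] is renamed to one in a single variable, which [Fresh] then
   discards. *)
have G0con : consistent G0.
  move=> b /prv_ren h1 /prv_ren h2.
  have G0S c : G0 c -> lifth (addh T (Not a)) (ren (fun=> None) c).
    by case=> d Td ->; exists d; rewrite // ren_ren; apply: eq_ren; case.
  apply: (con a); last exact: prv_hyp.
  apply: Fresh; apply: (@Raa _ _ _ _ (ren (fun=> None) b)); apply: prv_addh.
    exact: h1.
  exact: (h2 _ (fun=> None)).
have [M [r [x0 MG0]]] := henkin_model closed G0con.
have Mc c : addh T (Not a) c -> sat r c (of_void M).
  move=> Tc; have /MG0/sat_ren : G0 (ren (of_void nat) c) by exists c.
  by rewrite (_ : _ \o _ = of_void M) //; apply: funext; case.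
apply: (Mc (Not a)); first by right.
by apply: Ta => // c Tc; apply: Mc; left.
Qed.

(** * Semantics of connectives, blocks and interpretations *)

Lemma map_tuple_id {T : Type} n (v : n.-tuple T) : map_tuple id v = v.
Proof. by apply: val_inj; rewrite /= map_id. Qed.

Lemma map_tuple_comp {T T' T'' : Type} n (g : T' -> T'') (f : T -> T') (v : n.-tuple T) :
  map_tuple g (map_tuple f v) = map_tuple (g \o f) v.
Proof. by apply: val_inj; rewrite /= -map_comp. Qed.

Lemma of_void_uniq {T : Type} (e : void -> T) : e = of_void T.
Proof. by apply: funext; case. Qed.

(** The head of the tuple is the value of the innermost binder, in agreement with [bvars]. *)
Fixpoint extenv {V M : Type} (e : V -> M) n : n.-tuple M -> ext V n -> M :=
  if n is n'.+1 then fun xs => oapp (extenv e (behead_tuple xs)) (thead xs)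
  else fun=> e.

Lemma extenv_wk {V M : Type} (e : V -> M) n (xs : n.-tuple M) v :
  extenv e xs (wk n v) = e v.
Proof. by elim: n xs => //= n IHn xs. Qed.

Lemma extenv_comp_wk {V M : Type} (e : V -> M) n (xs : n.-tuple M) :
  extenv e xs \o wk n = e.
Proof. by apply: funext => v; apply: extenv_wk. Qed.

Lemma extenv_bvars {V M : Type} (e : V -> M) n (xs : n.-tuple M) :
  map_tuple (extenv e xs) (bvars n) = xs.
Proof.
elim: n xs => [|n IHn] xs; first by rewrite tuple0 [RHS]tuple0.
apply: val_inj; rewrite /= -map_comp [in RHS](tuple_eta xs) /=.
by congr (_ :: _); rewrite -[X in _ = X]/(val (behead_tuple xs)) -[in RHS](IHn (behead_tuple xs)).
Qed.

Lemma extenv_tnth_bvars {V M : Type} (e : V -> M) n (xs : n.-tuple M) i :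
  extenv e xs (tnth (bvars n) i) = tnth xs i.
Proof. by rewrite -[in RHS](extenv_bvars e xs) tnth_map. Qed.

Lemma extenv_cons {V M : Type} (e : V -> M) n x (xs : n.-tuple M) :
  extenv e (cons_tuple x xs) = oapp (extenv e xs) x.
Proof.
by rewrite /= theadE; congr (oapp (extenv _ _) _); apply: val_inj.
Qed.

Section SatConnectives.
Context {L : signature} {M : Type} (r : str L M).
Implicit Type V : Type.

Lemma sat_Imp V (a b : form L V) e : sat r (Imp a b) e <-> (sat r a e -> sat r b e).
Proof. by split=> /= [h ha|h [ha]]; [apply: contrapT => hb; apply: h | apply; apply: h]. Qed.

Lemma sat_Or V (a b : form L V) e : sat r (Or a b) e <-> sat r a e \/ sat r b e.
Proof.
split=> /= [h|[ha|hb] [na nb] //].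
by apply: contrapT => /not_orP[na nb]; apply: h.
Qed.

Lemma sat_Iff V (a b : form L V) e : sat r (Iff a b) e <-> (sat r a e <-> sat r b e).
Proof.
by split=> [[/sat_Imp h /sat_Imp h']|[h h']]; split => //; apply/sat_Imp.
Qed.

Lemma sat_Ex V (a : form L (option V)) e :
  sat r (Ex a) e <-> exists x, sat r a (oapp e x).
Proof.
split=> /= [h|[x hx] h]; last exact: h hx.
by apply: contrapT => h'; apply: h => x hx; apply: h'; exists x.
Qed.

Lemma sat_Conj V (s : seq (form L V)) e :
  sat r (Conj s) e <-> foldr and True [seq sat r a e | a <- s].
Proof. by elim: s => //= a s ->. Qed.

Lemma sat_EqT V n (x y : n.-tuple V) e :
  sat r (EqT x y) e <-> map_tuple e x = map_tuple e y.
Proof.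
rewrite /EqT; transitivity (map e x = map e y); last first.
  by split=> [h|[]//]; apply: val_inj.
move: (size_tuple x) (size_tuple y) => /esym.
move: (val x) (val y) => s t -> {x y}; elim: s t => [|x s IHs] [|y t] //= [st].
by rewrite IHs //; split=> [[-> ->]|[-> ->]].
Qed.

Lemma sat_Alls V n (a : form L (ext V n)) e :
  sat r (Alls a) e <-> forall xs : n.-tuple M, sat r a (extenv e xs).
Proof.
elim: n a => [|n IHn] a; first by split=> [h xs|/(_ [tuple])].
rewrite /= IHn /=; split=> [h xs|h xs x]; first exact: h.
by rewrite -extenv_cons; apply: h.
Qed.

Lemma sat_Exs V n (a : form L (ext V n)) e :
  sat r (Exs a) e <-> exists xs : n.-tuple M, sat r a (extenv e xs).
Proof.
rewrite /Exs /= sat_Alls; split=> [/existsNP[xs /contrapT]|[xs h] /(_ xs)//].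
by exists xs.
Qed.

End SatConnectives.

(** * Truth under a translation *)

Section Interpretation.
Context {L K : signature} (I : translation L K) {M N : Type}.
Variables (r : str K M) (z : (npar I).-tuple M) (rN : str L N).
Arguments rN R _ : clear implicits.
Variable rep : (dim I).-tuple M -> N -> Prop.

Definition dom_holds t :=
  sat r (domF I) (fun s => match s with inl c => tnth t c | inr j => tnth z j end).

Hypothesis rep_dom : forall t, dom_holds t <-> exists k, rep t k.
Hypothesis rep_onto : forall k, exists t, rep t k.
Hypothesis rep_eq : forall t t' k k', rep t k -> rep t' k' ->
  (sat r (eqF I) (env_at [tuple t; t'] z) <-> k = k').
Hypothesis rep_rel : forall R ts ks, (forall i, rep (tnth ts i) (tnth ks i)) ->
  (sat r (relF I R) (env_at ts z) <-> rN R ks).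

(** No quotient by the translated equality is formed: [rep t k] says that the block [t] names the
    element [k] of an abstract structure, possibly along with other blocks. Quantifiers transfer
    because every block in the domain names an element and every element has a name. *)
Lemma sat_tr {V : Type} (a : form L V) :
  forall (W : Type) (e : V -> (dim I).-tuple W) zz (rho : W -> M) (e' : V -> N),
  map_tuple rho zz = z -> (forall v, rep (map_tuple rho (e v)) (e' v)) ->
  sat r (tr I a e zz) rho <-> sat rN a e'.
Proof.
have envE (W : Type) n (ts : n.-tuple _) zz (rho : W -> M) : map_tuple rho zz = z ->
    rho \o env_at ts zz = env_at (map_tuple (map_tuple rho) ts) z.
  by move=> <-; apply: funext => -[[i c]|j] /=; rewrite !tnth_map.
elim: a => {V} [V R v|V x y|V a IHa b IHb|V a IHa|V a IHa] W e zz rho e' zzE ee' /=.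
- rewrite sat_ren envE //; apply: rep_rel => i.
  by rewrite !tnth_map.
- rewrite sat_ren envE //.
  rewrite (_ : map_tuple _ _ = [tuple map_tuple rho (e x); map_tuple rho (e y)]).
    exact: rep_eq.
  exact: val_inj.
- by rewrite (IHa _ _ _ _ e') // (IHb _ _ _ _ e').
- by rewrite (IHa _ _ _ _ e').
- rewrite sat_Alls.
  pose zz' := map_tuple (wk (dim I)) zz.
  have zz'E xs : map_tuple (extenv rho xs) zz' = z.
    by rewrite map_tuple_comp extenv_comp_wk.
  have domE xs : sat r (dom_at (bvars (dim I)) zz') (extenv rho xs) <-> dom_holds xs.
    rewrite /dom_at sat_ren /dom_holds (_ : _ \o _ = fun s =>
      match s with inl c => tnth xs c | inr j => tnth z j end) //.
    apply: funext => -[c|j] /=; last by rewrite -(zz'E xs) [in RHS]tnth_map.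
    exact: extenv_tnth_bvars.
  have eE xs k : rep xs k -> forall o, rep (map_tuple (extenv rho xs)
      (if o is Some v then map_tuple (wk (dim I)) (e v) else bvars (dim I)))
      (oapp e' k o).
    by move=> xk [v|] /=; rewrite ?extenv_bvars // map_tuple_comp extenv_comp_wk.
  split=> [h k|h xs].
    have [t tk] := rep_onto k.
    have /sat_Imp/(_ _)/(IHa _ _ _ _ _ (zz'E t) (eE _ _ tk)) := h t; apply.
    by apply/domE/rep_dom; exists k.
  apply/sat_Imp => /domE/rep_dom[k xk].
  exact/(IHa _ _ _ _ _ (zz'E xs) (eE _ _ xk)).
Qed.

End Interpretation.

(** * Kripke models *)

Section Kripke.
Context {L : signature} {W X : Type} (le : W -> W -> Prop).
Variable S : forall R : sym L, W -> (ar R).-tuple X -> Prop.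
Arguments S {R}.

(** Domains are constant, equality is identity, and an atom is forced when it holds at the world
    itself. Monotonicity and density of atoms, assumed below, reconcile this with the clause for
    atoms in [forces]. *)
Fixpoint forc {V : Type} (a : form L V) : W -> (V -> X) -> Prop :=
  match a with
  | Rel R v => fun p e => S p (map_tuple e v)
  | Eq x y => fun p e => e x = e y
  | And a b => fun p e => forc a p e /\ forc b p e
  | Not a => fun p e => forall q, le q p -> ~ forc a q e
  | All a => fun p e => forall q, le q p -> forall x, forc a q (oapp e x)
  end.

Hypothesis le_refl : forall p, le p p.
Hypothesis le_trans : forall p q s, le p q -> le q s -> le p s.
Hypothesis S_mono : forall p q R v, le q p -> @S R p v -> S q v.
(* This makes forcing an atom the same as its truth at the world. *)
Hypothesis S_dense : forall p R v,
  (forall q, le q p -> exists2 s, le s q & @S R s v) -> S p v.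
Implicit Type V : Type.

Lemma forc_mono V (a : form L V) : forall p q e, le q p -> forc a p e -> forc a q e.
Proof.
elim: a => {V} [V R v|V x y|V a IHa b IHb|V a IHa|V a IHa] p q e qp /=.
- exact: S_mono.
- by [].
- by case=> /(IHa _ _ _ qp) ? /(IHb _ _ _ qp).
- by move=> h s sq; apply/h/le_trans/qp.
- by move=> h s sq; apply/h/le_trans/qp.
Qed.

(** Density passes from atoms to all formulas because disjunction and existence are not primitive.
    It gives implication its usual clause in [forc_Imp]. *)
Lemma forc_dense V (a : form L V) : forall p e,
  (forall q, le q p -> exists2 s, le s q & forc a s e) -> forc a p e.
Proof.
elim: a => {V} [V R v|V x y|V a IHa b IHb|V a IHa|V a IHa] p e h /=.
- exact: S_dense.
- by have [s] := h p (le_refl p).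
- by split; [apply: IHa|apply: IHb] => q /h[s sq []]; exists s.
- move=> q qp aq; have [s sq hs] := h q qp.
  by apply: (hs s) => //; apply: forc_mono aq.
- move=> q qp x; apply: IHa => s sq.
  by have [t ts ht] := h s (le_trans sq qp); exists t => //; apply: ht.
Qed.

Lemma forc_All V (a : form L (option V)) p e :
  forc (All a) p e <-> forall x, forc a p (oapp e x).
Proof.
split=> [h x|h q qp x]; first exact: h.
exact: forc_mono qp (h x).
Qed.

Lemma forc_Imp V (a b : form L V) p e :
  forc (Imp a b) p e <-> forall q, le q p -> forc a q e -> forc b q e.
Proof.
split=> /= [h q qp aq|h q qp [aq nb]]; last exact: nb (h _ qp aq).
apply: forc_dense => s sq; apply: contrapT => ns.
apply: (h s (le_trans sq qp)); split; first exact: forc_mono aq.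
by move=> t ts bt; apply: ns; exists t.
Qed.

(** A disjunct is found only densely below [p], the disjunction being an abbreviation by negations;
    likewise for a witness in [forc_Ex]. *)
Lemma forc_Or V (a b : form L V) p e : forc (Or a b) p e <->
  forall q, le q p -> exists2 s, le s q & forc a s e \/ forc b s e.
Proof.
split=> /= h q qp.
  apply: contrapT => nq; apply: (h q qp).
  by split=> s sq hs; apply: nq; exists s => //; [left|right].
by move=> [na nb]; have [s sq [/(na _ sq)|/(nb _ sq)]] := h q qp.
Qed.

Lemma forc_Iff V (a b : form L V) p e : forc (Iff a b) p e <->
  forall q, le q p -> forc a q e <-> forc b q e.
Proof.
split=> [[/forc_Imp h /forc_Imp h'] q qp|h].
  by split; [apply: h|apply: h'].
by split; apply/forc_Imp => q /h[].
Qed.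

Lemma forc_Ex V (a : form L (option V)) p e : forc (Ex a) p e <->
  forall q, le q p -> exists2 s, le s q & exists x, forc a s (oapp e x).
Proof.
split=> /= h q qp.
  apply: contrapT => nq; apply: (h q qp) => s sq x t ts at_.
  by apply: nq; exists t; [apply: le_trans ts sq|exists x].
by move=> h'; have [s sq [x]] := h q qp; apply: h' sq x _ (le_refl s).
Qed.

Lemma forc_Alls V n (a : form L (ext V n)) p e :
  forc (Alls a) p e <-> forall xs : n.-tuple X, forc a p (extenv e xs).
Proof.
elim: n a => [|n IHn] a; first by split=> [h xs|/(_ [tuple])].
rewrite [Alls _]/(Alls (All a)) IHn; split=> [h xs|h xs].
  exact: (forc_All _ _ _).1 (h (behead_tuple xs)) (thead xs).
by apply/forc_All => x; rewrite -extenv_cons; apply: h.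
Qed.

Lemma forc_EqT V n (x y : n.-tuple V) p e :
  forc (EqT x y) p e <-> map_tuple e x = map_tuple e y.
Proof.
rewrite /EqT; transitivity (map e x = map e y); last first.
  by split=> [h|[]//]; apply: val_inj.
move: (size_tuple x) (size_tuple y) => /esym.
move: (val x) (val y) => s t -> {x y}; elim: s t => [|x s IHs] [|y t] //= [st].
by rewrite IHs //; split=> [[-> ->]|[-> ->]].
Qed.

Lemma forc_eq_axiom a p e : eq_axiom a -> forc a p e.
Proof.
case=> [|||R]; rewrite ?forc_All //.
- by move=> x; rewrite forc_All => y; rewrite forc_Imp.
- move=> x; rewrite forc_All => y; rewrite forc_All => t.
  by rewrite forc_Imp => q _ /= [-> ->].
- rewrite forc_Alls => xs; rewrite forc_Alls => ys; rewrite forc_Imp.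
  move=> q _ [/forc_EqT].
  by rewrite /= map_tuple_comp extenv_comp_wk !extenv_bvars => ->.
Qed.

End Kripke.

(** When atoms do not depend on the world, each clause of forcing collapses by reflexivity to that
    of truth. This makes an ordinary structure a one-world Kripke model. *)
Lemma forc_const {L : signature} {W X V : Type} (le : W -> W -> Prop) (r : str L X)
    (a : form L V) p e : (forall p, le p p) ->
  forc le (fun R _ => @r R) a p e <-> sat r a e.
Proof.
move=> le_refl; elim: a p e => {V} [V R v|V x y|V a IHa b IHb|V a IHa|V a IHa] p e //=.
- by rewrite IHa IHb.
- by split=> [/(_ p (le_refl p))|h q _]; rewrite IHa.
- by split=> [h x|h q _ x]; [apply/IHa/(h p)|apply/IHa/h].
Qed.

Lemma models_eq_axiom {L : signature} {M : Type} (r : str L M) : models r (@eq_axiom L).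
Proof.
move=> a /(@forc_eq_axiom _ unit _ (fun _ _ => True) (fun R _ => @r R)) h.
apply/(@forc_const _ unit _ _ (fun _ _ => True) _ _ tt) => //; apply: h => //.
by move=> p R v /(_ p I)[].
Qed.

(** * Sorted structures *)

Section SortedSemantics.
Context {M : msignature} {A : Type} (r : str (one_sorted M) A).
Implicit Type V : Type.

Definition has_sort (s : srt M) (x : A) : Prop := r (R := inl s) [tuple x].

Lemma sat_Srt V s (x : V) e : sat r (Srt s x) e <-> has_sort s (e x).
Proof.
rewrite /has_sort /= (_ : map_tuple _ _ = [tuple e x]) //; exact: val_inj.
Qed.

Lemma sat_AllS V s (a : form (one_sorted M) (option V)) e :
  sat r (AllS s a) e <-> forall x, has_sort s x -> sat r a (oapp e x).
Proof.
rewrite sat_All; split=> [h x sx|h x]; first by move: (h x) => /sat_Imp; apply; apply/sat_Srt.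
by apply/sat_Imp => /sat_Srt; apply: h.
Qed.

Lemma sat_ExS V s (a : form (one_sorted M) (option V)) e :
  sat r (ExS s a) e <-> exists2 x, has_sort s x & sat r a (oapp e x).
Proof.
rewrite sat_Ex; split=> [[x [/sat_Srt sx ax]]|[x sx ax]]; first by exists x.
by exists x; split=> //; apply/sat_Srt.
Qed.

Lemma sat_AllsS V s n (a : form (one_sorted M) (ext V n)) e : sat r (AllsS s n a) e <->
  forall xs : n.-tuple A, (forall i, has_sort s (tnth xs i)) -> sat r a (extenv e xs).
Proof.
elim: n a => [|n IHn] a.
  by split=> [h xs _|/(_ [tuple])]; [|apply=> -[]].
rewrite /= IHn; split=> [h xs sxs|h xs sxs].
  have /sat_AllS : sat r (AllS s a) (extenv e (behead_tuple xs)).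
    by apply: h => i; rewrite tnth_behead.
  apply; exact: sxs ord0.
apply/sat_AllS => x sx; rewrite -extenv_cons; apply: h => i.
by case: (unliftP ord0 i) => [j|] ->; rewrite ?tnthS ?tnth0.
Qed.

Lemma sat_Conj_zip B V n (s : n.-tuple B) (t : n.-tuple V)
    (f : B -> V -> form (one_sorted M) V) e :
  sat r (Conj [seq f p.1 p.2 | p <- zip s t]) e <->
  forall i, sat r (f (tnth s i) (tnth t i)) e.
Proof.
elim: n s t => [|n IHn] s t; first by rewrite tuple0 [t]tuple0; split=> // _ [].
case/tupleP: s => x s; case/tupleP: t => y t /=; rewrite IHn.
split=> [[h h'] i|h].
  by case: (unliftP ord0 i) => [j|] ->; rewrite ?tnthS ?tnth0.
split=> [|i]; first by have := h ord0; rewrite !tnth0.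
by have := h (lift ord0 i); rewrite !tnthS.
Qed.

Lemma sat_Disj_enum V (F : finType) (f : F -> form (one_sorted M) V) e :
  sat r (Disj [seq f s | s <- enum F]) e <-> exists s, sat r (f s) e.
Proof.
rewrite /Disj /=; suff -> : sat r (Conj [seq Not i | i <- [seq f i | i <- enum F]]) e <->
    forall s, ~ sat r (f s) e.
  by split=> [/existsNP[s /contrapT]|[s h] /(_ s)//]; exists s.
transitivity (forall s, s \in enum F -> ~ sat r (f s) e); last first.
  by split=> h s; [apply: h; rewrite mem_enum|].
elim: (enum F) => //= x s ->; split=> [[h h'] y|h].
  by rewrite inE => /orP[/eqP->|/h'].
by split=> [|y ys]; apply: h; rewrite inE ?eqxx ?ys ?orbT.
Qed.

Lemma models_sort_axiom : models r (sort_axiom M) <->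
  [/\ forall s, exists x, has_sort s x,
      forall x, exists s, has_sort s x,
      forall s s' x, s != s' -> has_sort s x -> ~ has_sort s' x &
      forall R v i, r (R := inr R) v -> has_sort (tnth (margs R) i) (tnth v i)].
Proof.
split=> [h|[h1 h2 h3 h4] _ [s||s s' ss'|R]].
- split=> [s|x|s s' x ss' sx s'x|R v i Rv].
  + by have /h/sat_Ex[x /sat_Srt] := sort_nonempty s; exists x.
  + have /sat_Disj_enum[s /sat_Srt] := (sat_All _ _ _).1 (h _ (@sort_cover M)) x; by exists s.
  + by apply: ((sat_All _ _ _).1 (h _ (sort_disjoint ss')) x); split; apply/sat_Srt.
  + have /sat_Alls/(_ v)/sat_Imp := h _ (sort_typing R).
    rewrite [X in X -> _]/= extenv_bvars => /(_ Rv)/sat_Conj_zip/(_ i)/sat_Srt.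
    by rewrite extenv_tnth_bvars.
- by have [x sx] := h1 s; apply/sat_Ex; exists x; apply/sat_Srt.
- by move=> x; have [s sx] := h2 x; apply/sat_Disj_enum; exists s; apply/sat_Srt.
- by move=> x [/sat_Srt sx /sat_Srt]; apply: h3 sx.
- apply/sat_Alls => v; apply/sat_Imp; rewrite [X in X -> _]/= extenv_bvars => Rv.
  apply/sat_Conj_zip => i; apply/sat_Srt.
  by rewrite extenv_tnth_bvars; apply: h4.
Qed.

End SortedSemantics.

(** * The two-sorted structure of a Kripke model with constant domain *)

Section KripkeStructure.
Context {L : signature} {W X : Type} (le : W -> W -> Prop).
Variable S : forall R : sym L, W -> (ar R).-tuple X -> Prop.
Arguments S {R}.

Definition star (R : option (sym L)) (p : W) : (pred_ar R).-tuple X -> Prop :=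
  match R return (pred_ar R).-tuple X -> Prop with
  | Some R => @S R p
  | None => fun v => thead v = thead (behead_tuple v)
  end.

(** The two sorts are the summands of [W + X]. The domain being constant, [D] holds of every world
    and every element. *)
Definition KMstr : str (KM_sig L) (W + X) := fun s =>
  match s return (@ar (KM_sig L) s).-tuple (W + X) -> Prop with
  | inl s => fun v => if thead v is inl _ then s else ~~ s
  | inr (inl true) => fun v =>
      if (thead v, thead (behead_tuple v)) is (inl p, inl q) then le p q else False
  | inr (inl false) => fun v =>
      if (thead v, thead (behead_tuple v)) is (inl p, inr x) then True else False
  | inr (inr R) => fun v =>
      exists p x, v = cons_tuple (inl p) (map_tuple inr x) /\ star (R := R) p x
  end.
Implicit Type V : Type.
Local Notation sat := (sat KMstr).

Lemma has_world x : has_sort KMstr (world : srt KM_msig) x <-> exists p, x = inl p.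
Proof. by case: x => x; split=> //; [exists x | case]. Qed.

Lemma has_elem x : has_sort KMstr (elem : srt KM_msig) x <-> exists y, x = inr y.
Proof. by case: x => x; split=> //; [case | exists x]. Qed.

Lemma sat_AllW V (a : form (KM_sig L) (option V)) e :
  sat (AllS (world : srt KM_msig) a) e <-> forall p, sat a (oapp e (inl p)).
Proof.
rewrite sat_AllS; split=> [h p|h _ /has_world[p ->]//].
by apply: h; apply/has_world; exists p.
Qed.

Lemma sat_AllX V (a : form (KM_sig L) (option V)) e :
  sat (AllS (elem : srt KM_msig) a) e <-> forall x, sat a (oapp e (inr x)).
Proof.
rewrite sat_AllS; split=> [h p|h _ /has_elem[p ->]//].
by apply: h; apply/has_elem; exists p.
Qed.

Lemma sat_ExW V (a : form (KM_sig L) (option V)) e :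
  sat (ExS (world : srt KM_msig) a) e <-> exists p, sat a (oapp e (inl p)).
Proof.
rewrite sat_ExS; split=> [[_ /has_world[p ->]]|[p]]; first by exists p.
by exists (inl p) => //; apply/has_world; exists p.
Qed.

Lemma sat_ExX V (a : form (KM_sig L) (option V)) e :
  sat (ExS (elem : srt KM_msig) a) e <-> exists x, sat a (oapp e (inr x)).
Proof.
rewrite sat_ExS; split=> [[_ /has_elem[p ->]]|[p]]; first by exists p.
by exists (inr p) => //; apply/has_elem; exists p.
Qed.

Lemma sat_AllsX V n (a : form (KM_sig L) (ext V n)) e :
  sat (AllsS (elem : srt KM_msig) n a) e <->
  forall xs : n.-tuple X, sat a (extenv e (map_tuple inr xs)).
Proof.
rewrite sat_AllsS; split=> [h xs|h xs sxs].
  by apply: h => i; apply/has_elem; exists (tnth xs i); rewrite tnth_map.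
have [ys ->] : exists ys : n.-tuple X, xs = map_tuple inr ys; last exact: h.
have [f fP] := choice (fun i => (has_elem _).1 (sxs i)).
exists [tuple f i | i < n].
by apply: eq_from_tnth => i; rewrite tnth_map tnth_mktuple.
Qed.

Lemma sat_Leq V (p q : V) e p' q' : e p = inl p' -> e q = inl q' ->
  sat (Leq p q) e <-> le p' q'.
Proof.
rewrite -[sat _ _]/(if (e p, e q) is (inl p', inl q') then le p' q' else False).
by move=> -> ->.
Qed.

Lemma sat_InD V (p x : V) e p' x' : e p = inl p' -> e x = inr x' ->
  sat (InD p x) e.
Proof.
rewrite -[sat _ _]/(if (e p, e x) is (inl p', inr x') then True else False).
by move=> -> ->.
Qed.

Lemma sat_Star V R (p : V) x e p' (x' : (pred_ar R).-tuple X) :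
  e p = inl p' -> map_tuple e x = map_tuple inr x' ->
  sat (Star p x) e <-> star p' x'.
Proof.
move=> ep ex; rewrite /= (_ : map_tuple _ _ = cons_tuple (inl p') (map_tuple inr x')).
  split=> [[q [y [[-> /inj_map xy]]]]|px]; last by exists p', x'.
  by rewrite (_ : x' = y) //; apply: val_inj; apply: xy => ? ? [].
by apply: val_inj; rewrite /= ep; congr (_ :: _); apply: (congr1 val ex).
Qed.

Hypothesis le_refl : forall p, le p p.
Hypothesis le_trans : forall p q s, le p q -> le q s -> le p s.
Hypothesis S_mono : forall p q R v, le q p -> @S R p v -> S q v.
Hypothesis S_dense : forall p R v,
  (forall q, le q p -> exists2 s, le s q & @S R s v) -> S p v.

(** Monotonicity and density of [S] identify the forcing of an atom with its truth at [p']; equality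
    does not vary with the world. *)
Lemma sat_forces_atom V R (p : V) x e p' (x' : (pred_ar R).-tuple X) :
  e p = inl p' -> map_tuple e x = map_tuple inr x' ->
  sat (forces_atom p x) e <-> star p' x'.
Proof.
move=> ep ex; rewrite sat_AllW.
have sx q s : sat (And (Leq v0 v1) (Star v0 (map_tuple (fun v => Some (Some v)) x)))
   (oapp (oapp e (inl q)) (inl s)) <-> le s q /\ star s x'.
  rewrite -[X in X <-> _]/(le s q /\ sat (Star v0 _) _).
  rewrite (@sat_Star _ _ _ _ _ s x') //.
  by rewrite map_tuple_comp.
transitivity (forall q, le q p' -> exists s, le s q /\ star s x').
  split=> h q; first move=> qp.
    have /sat_Imp := h q; rewrite (@sat_Leq _ _ _ _ q p') // => /(_ qp)/sat_ExW[s].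
    by move=> /sx; exists s.
  apply/sat_Imp; rewrite (@sat_Leq _ _ _ _ q p') // => /h[s hs].
  by apply/sat_ExW; exists s; apply/sx.
case: R x x' {sx} ex => [R|] x x' /= ex; split=> h.
- by apply: S_dense => q /h[s []]; exists s.
- by move=> q qp; exists q; split=> //; apply: S_mono h.
- by have [s []] := h _ (le_refl p').
- by move=> q qp; exists q.
Qed.

Lemma sat_forces V (a : form L V) : forall V' (p : V') (e : V -> V') rho p' e',
  rho p = inl p' -> (forall v, rho (e v) = inr (e' v)) ->
  sat (forces a p e) rho <-> forc le (@S) a p' e'.
Proof.
elim: a => {V} [V R v|V x y|V a IHa b IHb|V a IHa|V a IHa] V' p e rho p' e' pp' ee'.
- apply: (@sat_forces_atom _ (Some R)) => //.
  by rewrite !map_tuple_comp; apply: eq_from_tnth => i; rewrite !tnth_map /= ee'.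
- apply: (sat_forces_atom (R := None) (x' := [tuple e' x; e' y]) pp').
  by apply: val_inj; rewrite /= !ee'.
- by rewrite [X in X <-> _]/= (IHa _ _ _ _ p' e') // (IHb _ _ _ _ p' e').
- rewrite [forces _ _ _]/= sat_AllW.
  have key q : sat (forces a None (fun v => Some (e v))) (oapp rho (inl q)) <->
      forc le (@S) a q e' by apply: IHa.
  split=> [h q qp|h q].
    by have /sat_Imp := h q; rewrite (@sat_Leq _ _ _ _ q p') // => /(_ qp) nq /key.
  by apply/sat_Imp; rewrite (@sat_Leq _ _ _ _ q p') // => qp /key; apply: h.
- rewrite [forces _ _ _]/= sat_AllW.
  have eE q x : forall o, oapp (oapp rho (inl q)) (inr x)
      (if o is Some v then Some (Some (e v)) else None) = inr (oapp e' x o).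
    by case.
  split=> [h q qp x|h q].
    have /sat_Imp := h q; rewrite (@sat_Leq _ _ _ _ q p') // => /(_ qp)/sat_AllX/(_ x)/sat_Imp.
    move=> /(_ (sat_InD (p' := q) (x' := x) erefl erefl)).
    by rewrite (IHa _ _ _ _ q (oapp e' x)).
  apply/sat_Imp; rewrite (@sat_Leq _ _ _ _ q p') // => qp.
  apply/sat_AllX => x; apply/sat_Imp => _.
  by rewrite (IHa _ _ _ _ q (oapp e' x)) //; apply: h.
Qed.

Lemma models_KM (U : theory L) : W -> X ->
  (forall a p, U a -> forc le (@S) a p (of_void X)) -> models KMstr (KM U).
Proof.
move=> w0 x0 Uforc.
have forcesE a : (forall p, forc le (@S) a p (of_void X)) ->
    sat (AllS (world : srt KM_msig) (forces a None (fun v => of_void _ v))) (of_void _).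
  by move=> h; apply/sat_AllW => p; apply/(@sat_forces _ a _ _ _ _ p (of_void X)).
move=> _ [a sa|||||R|R|a Ua|a ea].
- move: a sa; apply/models_sort_axiom; split.
  + by case; [exists (inl w0)|exists (inr x0)].
  + by case=> x; [exists true|exists false].
  + by case=> -[] // [] x.
  + case=> [[]|R] v i.
    * case/tupleP: v => -[p|//] v; case/tupleP: v => -[q|//] v _.
      by case: i => -[|[|//]] j.
    * case/tupleP: v => -[p|//] v; case/tupleP: v => -[//|x] v _.
      by case: i => -[|[|//]] j.
    * move=> [p [x [-> _]]].
      by case: (unliftP ord0 i) => [j|] ->; rewrite ?tnthS ?tnth0 ?tnth_nseq ?tnth_map.
- by apply/sat_AllW => p; apply: le_refl.
- apply/sat_AllW => p; apply/sat_AllW => q; apply/sat_AllW => s.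
  by apply/sat_Imp => -[]; apply: le_trans.
- by apply/sat_AllW => p; apply/sat_ExX; exists x0.
- apply/sat_AllW => p; apply/sat_AllW => q; apply/sat_Imp => _.
  by apply/sat_AllX => x; apply/sat_Imp.
- apply/sat_AllW => p; apply/sat_AllsX => xs; apply/sat_Imp => _.
  apply/sat_Conj; set y := wk _ _; have yE : extenv (oapp (of_void _) (inl p))
    (map_tuple (@inr W X) xs) y = inl p by apply: extenv_wk.
  (* The conjunction is a fold over a list; the boolean [all] gives access to its entries by
     index. *)
  suff : all (fun v => `[< sat (InD y v) (extenv (oapp (of_void _) (inl p))
      (map_tuple (@inr W X) xs)) >]) (bvars (pred_ar R)).
    by elim: (val _) => //= v s IHs /andP[/asboolP ? /IHs].
  apply/all_tnthP => i; apply/asboolP.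
  by apply: (@sat_InD _ _ _ _ p (tnth xs i)); rewrite // extenv_tnth_bvars tnth_map.
- apply/sat_AllW => p; apply/sat_AllW => q; apply/sat_AllsX => xs; apply/sat_Imp.
  move=> [/(@sat_Leq _ _ _ _ q p)]; rewrite !extenv_wk => /(_ erefl erefl) qp.
  move=> /(@sat_Star _ R _ _ _ p xs); rewrite extenv_wk extenv_bvars => /(_ erefl erefl) pxs.
  apply/(@sat_Star _ R _ _ _ q xs); rewrite ?extenv_wk ?extenv_bvars //.
  case: R xs pxs => [R|] //= xs; exact: S_mono.
- by apply: forcesE => p; apply: Uforc.
- by apply: forcesE => p; apply: forc_eq_axiom.
Qed.

End KripkeStructure.

(** * Definability *)

(** One formula must serve all structures. It is kept as data, since it becomes part of a
    translation. *)
Definition definable {K : signature} {V : Type}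
    (P : forall M : Type, str K M -> (V -> M) -> Prop) : Type :=
  {a : form K V | forall M (r : str K M) e, sat r a e <-> P M r e}.

Section Definability.
Context {K : signature}.
Implicit Type V : Type.

Lemma def_ext V (P Q : forall M : Type, str K M -> (V -> M) -> Prop) :
  definable P -> (forall M r e, P M r e <-> Q M r e) -> definable Q.
Proof. by move=> [a aP] PQ; exists a => M r e; rewrite aP. Qed.

Lemma def_ren V V' (f : V -> V') (P : forall M : Type, str K M -> (V -> M) -> Prop) :
  definable P -> definable (fun M r e => P M r (fun v => e (f v))).
Proof. by move=> [a aP]; exists (ren f a) => M r e; rewrite sat_ren. Qed.

Lemma def_and V (P Q : forall M : Type, str K M -> (V -> M) -> Prop) :
  definable P -> definable Q -> definable (fun M r e => P M r e /\ Q M r e).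
Proof. by move=> [a aP] [b bQ]; exists (And a b) => M r e; rewrite /= aP bQ. Qed.

Lemma def_and3 V (P Q R : forall M : Type, str K M -> (V -> M) -> Prop) :
  definable P -> definable Q -> definable R ->
  definable (fun M r e => [/\ P M r e, Q M r e & R M r e]).
Proof.
move=> dP dQ dR; apply: def_ext (def_and dP (def_and dQ dR)) _ => M r e.
by split=> [[? []]|[]].
Qed.

Lemma def_and4 V (P Q R S : forall M : Type, str K M -> (V -> M) -> Prop) :
  definable P -> definable Q -> definable R -> definable S ->
  definable (fun M r e => [/\ P M r e, Q M r e, R M r e & S M r e]).
Proof.
move=> dP dQ dR dS; apply: def_ext (def_and dP (def_and3 dQ dR dS)) _ => M r e.
by split=> [[? []]|[]].
Qed.

Lemma def_or V (P Q : forall M : Type, str K M -> (V -> M) -> Prop) :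
  definable P -> definable Q -> definable (fun M r e => P M r e \/ Q M r e).
Proof. by move=> [a aP] [b bQ]; exists (Or a b) => M r e; rewrite sat_Or aP bQ. Qed.

Lemma def_imp V (P Q : forall M : Type, str K M -> (V -> M) -> Prop) :
  definable P -> definable Q -> definable (fun M r e => P M r e -> Q M r e).
Proof. by move=> [a aP] [b bQ]; exists (Imp a b) => M r e; rewrite sat_Imp aP bQ. Qed.

Lemma def_iff V (P Q : forall M : Type, str K M -> (V -> M) -> Prop) :
  definable P -> definable Q -> definable (fun M r e => P M r e <-> Q M r e).
Proof. by move=> [a aP] [b bQ]; exists (Iff a b) => M r e; rewrite sat_Iff aP bQ. Qed.

Lemma def_not V (P : forall M : Type, str K M -> (V -> M) -> Prop) :
  definable P -> definable (fun M r e => ~ P M r e).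
Proof. by move=> [a aP]; exists (Not a) => M r e; rewrite /= aP. Qed.

(** The bound element is the value of the new variable [None]. In this form unification reads
    formulas off from predicates, and they need never be written. *)
Lemma def_all V (P : forall M : Type, str K M -> (V -> M) -> M -> Prop) :
  definable (fun M r (e : option V -> M) => P M r (fun v => e (Some v)) (e None)) ->
  definable (fun M r e => forall x, P M r e x).
Proof.
move=> [a aP]; exists (All a) => M r e; rewrite sat_All; split=> h x.
  exact: (aP _ _ (oapp e x)).1 (h x).
exact: (aP _ _ (oapp e x)).2 (h x).
Qed.

Lemma def_ex V (P : forall M : Type, str K M -> (V -> M) -> M -> Prop) :
  definable (fun M r (e : option V -> M) => P M r (fun v => e (Some v)) (e None)) ->
  definable (fun M r e => exists x, P M r e x).
Proof.
move=> [a aP]; exists (Ex a) => M r e; rewrite sat_Ex.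
split=> -[x hx]; exists x; first exact: (aP _ _ (oapp e x)).1 hx.
exact: (aP _ _ (oapp e x)).2 hx.
Qed.

Lemma def_all_ord V n (P : 'I_n -> forall M : Type, str K M -> (V -> M) -> Prop) :
  (forall i, definable (P i)) -> definable (fun M r e => forall i, P i M r e).
Proof.
move=> h; exists (Conj [seq projT1 (h i) | i <- enum 'I_n]) => M r e.
rewrite sat_Conj -map_comp.
transitivity (forall i, i \in enum 'I_n -> P i M r e); last first.
  by split=> hP i; [apply: hP; rewrite mem_enum|].
elim: (enum _) => //= j s ->; split=> [[hj hs] i|hP].
  by rewrite inE => /orP[/eqP->|/hs//]; apply/(projT2 (h j)).
by split=> [|i si]; [apply/(projT2 (h j))|]; apply: hP; rewrite inE ?eqxx ?si ?orbT.
Qed.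

Lemma def_eq V (x y : V) : definable (fun M (_ : str K M) e => e x = e y).
Proof. by exists (Eq x y). Qed.

Lemma def_rel V R (v : (ar R).-tuple V) :
  definable (fun M (r : str K M) e => r R (map_tuple e v)).
Proof. by exists (Rel R v). Qed.

End Definability.

Ltac definability := repeat
  first [apply: def_eq | apply: def_iff | apply: def_and | apply: def_and3 | apply: def_and4 | apply: def_or
       | apply: def_not | apply: def_imp | apply: def_all | apply: def_ex].

(** The translation takes no parameters. By completeness it is enough that in each model of [T] the
    defined structure is, through [rep], a model of [U]; the equality axioms then hold because [eqv]
    is identity in [N]. *)
Lemma interprets_def {K L : signature} (T : theory K) (U : theory L) d
    (dom : forall M : Type, str K M -> ('I_d -> M) -> Prop)
    (eqv : forall M : Type, str K M -> ('I_2 * 'I_d -> M) -> Prop)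
    (rel : forall (R : sym L) M, str K M -> ('I_(ar R) * 'I_d -> M) -> Prop) :
  0 < d -> definable dom -> definable eqv -> (forall R, definable (rel R)) ->
  (forall M (r : str K M), M -> models r T ->
   exists (N : Type) (rN : str L N) (rep : ('I_d -> M) -> N -> Prop) (n0 : N),
   [/\ forall t, dom M r t <-> exists k, rep t k,
       forall k, exists t, rep t k,
       forall t t' k k', rep t k -> rep t' k' ->
         (eqv M r (fun ic => (if ic.1 == ord0 then t else t') ic.2) <-> k = k'),
       forall R (ts : 'I_(ar R) -> 'I_d -> M) ks, (forall i, rep (ts i) (tnth ks i)) ->
         (rel R M r (fun ic => ts ic.1 ic.2) <-> rN R ks) &
       models rN U]) ->
  interprets T U.
Proof.
move=> d0 [domF domFP] [eqF eqFP] relD MN.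
pose I := @Translation L K d 0 Top (ren inl domF) (ren inl eqF)
  (fun R => ren inl (projT1 (relD R))).
exists I; split=> //.
  apply: completeness => M r x0 _; rewrite sat_Exs; exists [tuple].
  by rewrite /par_at sat_ren.
move=> a Ua; apply: completeness => M r x0 MT; rewrite sat_Alls => z.
apply/sat_Imp => _.
have [N [rN [rep [n0 [rep_dom rep_onto rep_eq rep_rel NU]]]]] := MN M r x0 MT.
pose rep' (t : d.-tuple M) k := rep (tnth t) k.
have tnthK (f : 'I_d -> M) : tnth [tuple f i | i < d] = f.
  by apply: funext => i; rewrite tnth_mktuple.
have NUa : sat rN a (of_void N).
  case: Ua => [b /NU//|b /(models_eq_axiom rN)//|].
  by apply/sat_Ex; exists n0 => x.
apply/(@sat_tr _ _ I _ _ r z rN rep' _ _ _ _ _ _ _ _ _ _ (of_void N)); rewrite ?extenv_bvars //.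
- move=> t; rewrite -rep_dom -domFP /dom_holds sat_ren.
  exact: iff_refl.
- by move=> k; have [f fk] := rep_onto k; exists [tuple f i | i < d]; rewrite /rep' tnthK.
- move=> t t' k k' tk tk'; rewrite -(rep_eq _ _ _ _ tk tk') -eqFP sat_ren.
  rewrite (_ : _ \o _ = fun ic => tnth (if ic.1 == ord0 then t else t') ic.2).
    rewrite (_ : (fun ic => (if ic.1 == ord0 then tnth t else tnth t') ic.2) =
      fun ic : 'I_2 * 'I_d => tnth (if ic.1 == ord0 then t else t') ic.2).
      exact: iff_refl.
    by apply: funext => -[i c] /=; case: ifP.
  by apply: funext => -[i c] /=; case: i => -[|[|//]] j.
- move=> R ts ks tsks.
  rewrite -(rep_rel _ _ _ tsks) -(projT2 (relD R)) sat_ren.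
  rewrite (_ : _ \o _ = fun ic => tnth (tnth ts ic.1) ic.2); first exact: iff_refl.
  by apply: funext => -[i c].
Qed.

(** * Forcing-interpretations from definable Kripke models *)

Definition pair_env {d} {M : Type} (t t' : 'I_d -> M) (bc : bool * 'I_d) : M :=
  (if bc.1 then t else t') bc.2.

Section ForcingInterpretation.
Context {K L : signature} {d : nat}.
Variables domW domX : forall M : Type, str K M -> ('I_d -> M) -> Prop.
Variables eqW eqX leW : forall M : Type, str K M -> (bool * 'I_d -> M) -> Prop.
Variable st : forall (R : sym L) (M : Type), str K M -> (option 'I_(ar R) * 'I_d -> M) -> Prop.

(* [kripke_rep r le S]: the Kripke model [(W, X, le, S)] is isomorphic to the
   one which the families above define in [r]. *)
Definition kripke_rep {M : Type} (r : str K M) {W X : Type} (le : W -> W -> Prop)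
    (S : forall R : sym L, W -> (ar R).-tuple X -> Prop) : Prop :=
  exists (repW : ('I_d -> M) -> W -> Prop) (repX : ('I_d -> M) -> X -> Prop),
  [/\ (forall t, domW r t <-> exists p, repW t p) /\ (forall t, domX r t <-> exists x, repX t x),
      (forall p, exists t, repW t p) /\ (forall x, exists t, repX t x),
      forall t, domW r t -> ~ domX r t,
      (forall t t' p p', repW t p -> repW t' p' ->
         (eqW r (pair_env t t') <-> p = p') /\ (leW r (pair_env t t') <-> le p p')) /\
      (forall t t' x x', repX t x -> repX t' x' -> eqX r (pair_env t t') <-> x = x') &
      forall R t ts p xs, repW t p -> (forall i, repX (ts i) (tnth xs i)) ->
        st r (fun oc : option 'I_(ar R) * 'I_d => oapp ts t oc.1 oc.2) <-> S R p xs].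

Definition km_dom {M : Type} (r : str K M) e := domW r e \/ domX r e.

(** The guards keep worlds and elements distinct, [eqW] and [eqX] being meaningful only within one
    sort. *)
Definition km_eq {M : Type} (r : str K M) (e : 'I_2 * 'I_d -> M) :=
  let t c := e (ord0, c) in let t' c := e (ord_max, c) in
  (domW r t /\ domW r t') /\ eqW r (pair_env t t') \/
  (domX r t /\ domX r t') /\ eqX r (pair_env t t').

(** Block [ord0] is the world and block [lift ord0 i] the argument [i], so the two sides of an
    equality are blocks 1 and 2. *)
Definition km_star (R : option (sym L)) :
    forall M : Type, str K M -> ('I_(pred_ar R).+1 * 'I_d -> M) -> Prop :=
  match R return forall M : Type, str K M -> ('I_(pred_ar R).+1 * 'I_d -> M) -> Prop with
  | None => fun M r e =>
      eqX r (pair_env (fun c => e (lift ord0 ord0, c)) (fun c => e (ord_max, c)))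
  | Some R => fun M r e => st (R := R) r (fun oc => e (oapp (lift ord0) ord0 oc.1, oc.2))
  end.

Definition km_rel (R : sym (KM_sig L)) :
    forall M : Type, str K M -> ('I_(ar R) * 'I_d -> M) -> Prop :=
  match R return forall M : Type, str K M -> ('I_(@ar (KM_sig L) R) * 'I_d -> M) -> Prop with
  | inl true => fun M r e => domW r (fun c => e (ord0, c))
  | inl false => fun M r e => domX r (fun c => e (ord0, c))
  | inr (inl true) => fun M r e =>
      let t c := e (ord0, c) in let t' c := e (ord_max, c) in
      (domW r t /\ domW r t') /\ leW r (pair_env t t')
  | inr (inl false) => fun M r e =>
      domW r (fun c => e (ord0, c)) /\ domX r (fun c => e (ord_max, c))
  | inr (inr R) => fun M r e =>
      (domW r (fun c => e (ord0, c)) /\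
       forall i, domX r (fun c => e (lift ord0 i, c))) /\ km_star (R := R) r e
  end.

Hypothesis domW_def : definable (@domW).
Hypothesis domX_def : definable (@domX).
Hypothesis eqW_def : definable (@eqW).
Hypothesis eqX_def : definable (@eqX).
Hypothesis leW_def : definable (@leW).
Hypothesis st_def : forall R, definable (@st R).

Lemma km_dom_def : definable (@km_dom).
Proof. exact: def_or. Qed.

Lemma def_pair (V : Type) (f g : 'I_d -> V)
    (P : forall M : Type, str K M -> (bool * 'I_d -> M) -> Prop) :
  definable P ->
  definable (fun M r (e : V -> M) => P M r (pair_env (fun c => e (f c)) (fun c => e (g c)))).
Proof.
move=> /(def_ren (fun bc : bool * 'I_d => if bc.1 then f bc.2 else g bc.2)).
move/def_ext; apply => M r e.
rewrite (_ : (fun v => _) = pair_env (fun c => e (f c)) (fun c => e (g c))) //.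
by apply: funext => -[[] c].
Qed.

Lemma km_eq_def : definable (@km_eq).
Proof.
by apply: def_or; (apply: def_and; [apply: def_and; exact: def_ren|exact: def_pair]).
Qed.

Lemma km_rel_def R : definable (@km_rel R).
Proof.
case: R => [[]|[[]|R]].
- exact: (def_ren (fun c => (ord0, c))).
- exact: (def_ren (fun c => (ord0, c))).
- by apply: def_and; [apply: def_and; exact: def_ren|exact: def_pair].
- by apply: def_and; exact: def_ren.
- apply: def_and; first apply: def_and.
  + exact: (def_ren (fun c => (ord0, c))).
  + by apply: def_all_ord => i; exact: (def_ren (fun c => (lift ord0 i, c))).
  + case: R => [R|].
      exact: (def_ren (fun oc : option 'I_(ar R) * 'I_d => (oapp (lift ord0) ord0 oc.1, oc.2)) (st_def R)).
    exact: (def_pair (fun c => (lift ord0 ord0, c)) (fun c => (ord_max, c))).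
Qed.

(** The structure defined on worlds and elements together is [KMstr], a model of [KM U] by
    [models_KM]; its worlds are named through [repW] and its elements through [repX]. *)
Theorem forcing_interprets_def (T : theory K) (U : theory L) : 0 < d ->
  (forall M (r : str K M), M -> models r T ->
   exists (W X : Type) (le : W -> W -> Prop)
     (S : forall R : sym L, W -> (ar R).-tuple X -> Prop) (p0 : W) (x0 : X),
   [/\ (forall p, le p p) /\ (forall p q s, le p q -> le q s -> le p s),
       forall p q R v, le q p -> S R p v -> S R q v,
       forall p R v, (forall q, le q p -> exists2 s, le s q & S R s v) -> S R p v,
       forall a p, U a -> forc le S a p (of_void X) &
       kripke_rep r le S]) ->
  forcing_interprets T U.
Proof.
move=> d0 TU; apply: interprets_def d0 km_dom_def km_eq_def km_rel_def _ => M r m0 MT.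
have [W [X [le [S [p0 [x0 [[le_refl le_trans] S_mono S_dense Uforc]]]]]]] := TU M r m0 MT.
move=> [repW [repX [[domWP domXP] [repWs repXs] domWX [repW_eq repX_eq] repS]]].
pose rep t (k : W + X) := match k with inl p => repW t p | inr x => repX t x end.
have domWE t k : rep t k -> domW r t <-> if k is inl _ then True else False.
  case: k => [p|x] /= tk; first by split=> // _; apply/domWP; exists p.
  by split=> // /domWX; apply; apply/domXP; exists x.
have domXE t k : rep t k -> domX r t <-> if k is inl _ then False else True.
  case: k => [p|x] /= tk; last by split=> // _; apply/domXP; exists x.
  by split=> // tX; have /domWX := (domWP t).2 (ex_intro _ _ tk).
exists (W + X)%type, (KMstr le S), rep, (inl p0); split.
- move=> t; split=> [[/domWP[p tp]|/domXP[x tx]]|[[p|x] tk]].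
  + by exists (inl p).
  + by exists (inr x).
  + by left; apply/domWP; exists p.
  + by right; apply/domXP; exists x.
- by case.
- move=> t t' k k' tk tk'; rewrite /km_eq /= (domWE _ _ tk) (domWE _ _ tk') (domXE _ _ tk) (domXE _ _ tk').
  case: k k' tk tk' => [p|x] [p'|x'] /= tk tk'.
  + have [-> _] := repW_eq _ _ _ _ tk tk'.
    by split=> [[[_ ->]|[[[]]]]|[->]]; last left.
  + by split=> [[[[]]|[[]]]|].
  + by split=> [[[[]]|[[]]]|].
  + rewrite (repX_eq _ _ _ _ tk tk').
    by split=> [[[[[]]]|[_ ->]]|[->]]; last right.
- case=> [s|[b|R]] ts ks tsks.
  + have E := (domWE _ _ (tsks ord0), domXE _ _ (tsks ord0)).
    by case: s ts ks tsks E => ts ks tsks E /=; rewrite E /thead; case: (tnth ks ord0).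
  + have E0 := (domWE _ _ (tsks ord0), domXE _ _ (tsks ord0)).
    have E1 := (domWE _ _ (tsks ord_max), domXE _ _ (tsks ord_max)).
    have thead1 (v : 2.-tuple (W + X)) : thead (behead_tuple v) = tnth v ord_max.
      by case/tupleP: v => ? v; case/tupleP: v.
    case: b ts ks tsks E0 E1 => ts ks tsks E0 E1; rewrite /= thead1 !E0 !E1 /thead;
      move: (tsks ord0) (tsks ord_max);
      case: (tnth ks ord0) => [p|x]; case: (tnth ks ord_max) => [q|y] //= tp tq; try tauto.
    by have [_ ->] := repW_eq _ _ _ _ tp tq; tauto.
  + rewrite -[KMstr _ _ _]/(exists p x, ks = cons_tuple (inl p) (map_tuple inr x) /\ star S p x).
    have starE p x : repW (ts ord0) p -> (forall i, repX (ts (lift ord0 i)) (tnth x i)) ->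
        km_star (R := R) r (fun ic => ts ic.1 ic.2) <-> star S p x.
      case: R ts ks tsks x => [R|] ts ks tsks x tp tx /=.
        rewrite -(repS _ _ _ _ _ tp tx).
        rewrite (_ : (fun oc => _) = fun oc => oapp (fun i => ts (lift ord0 i)) (ts ord0) oc.1 oc.2).
          exact: iff_refl.
        by apply: funext => -[[i|] c].
      have -> : thead (behead_tuple x) = tnth x ord_max.
        by case/tupleP: x {tx} => ? v; case/tupleP: v.
      rewrite -(repX_eq _ _ _ _ (tx ord0) (tx ord_max)).
      by rewrite (_ : lift ord0 ord_max = ord_max) //; apply: val_inj.
    split=> [[[tW tX] tS]|[p [x [ksE px]]]].
      have [p pE] : exists p, tnth ks ord0 = inl p.
        have /(domWE _ _ (tsks ord0)) := tW.
        by case: (tnth ks ord0) => // p _; exists p.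
      have /choice[x xE] i : exists x, tnth ks (lift ord0 i) = inr x.
        have /(domXE _ _ (tsks (lift ord0 i))) := tX i.
        by case: (tnth ks _) => // x _; exists x.
      exists p, [tuple x i | i < pred_ar R]; split.
        apply: eq_from_tnth => i; case: (unliftP ord0 i) => [j|] ->; last by rewrite pE.
        by rewrite xE tnthS tnth_map tnth_mktuple.
      apply/starE => // [|i]; first by have := tsks ord0; rewrite pE.
      by have := tsks (lift ord0 i); rewrite xE tnth_mktuple.
    have tp : repW (ts ord0) p by have := tsks ord0; rewrite ksE.
    have tx i : repX (ts (lift ord0 i)) (tnth x i).
      by have := tsks (lift ord0 i); rewrite ksE tnthS tnth_map.
    split; last exact/(starE _ _ tp tx).
    by split=> [|i]; [apply/(domWP (ts ord0)); exists p|apply/(domXP (ts (lift ord0 i))); exists (tnth x i)].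
- exact: models_KM.
Qed.

End ForcingInterpretation.

(** * Models of adjunctive classes *)

Section ACModels.
Context {L : signature} {n : nat} {M : Type} (r : str (AC_sig L n) M).

Definition isO (x : M) := has_sort r (obj : srt (AC_msig L n)) x.
Definition isC (k : 'I_n) (x : M) := has_sort r (cls k : srt (AC_msig L n)) x.
Definition mem_cls (k : 'I_n) (X : M) (x : k.+1.-tuple M) : Prop :=
  r (R := inr (inr k) : sym (AC_sig L n)) (cons_tuple X x).

Lemma sat_Mem {V : Type} (k : 'I_n) (x : k.+1.-tuple V) X e :
  sat r (Mem x X : form (AC_sig L n) V) e <-> mem_cls (e X) (map_tuple e x).
Proof.
rewrite /mem_cls -[sat _ _ _]/(r (R := inr (inr k) : sym (AC_sig L n)) (map_tuple e (cons_tuple X x))).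
rewrite (_ : map_tuple e (cons_tuple X x) = cons_tuple (e X) (map_tuple e x)) //.
exact: val_inj.
Qed.

(** The objects are given as the image of an injection [j], so that they may be a tagged copy of a
    model of sets as well as a subtype of a model of classes. *)
Lemma sat_relativize {A : Type} (rA : str L A) (j : A -> M) :
  injective j -> (forall x, isO x <-> exists y, x = j y) ->
  (forall R v, r (R := inr (inl R) : sym (AC_sig L n)) (map_tuple j v) <-> rA R v) ->
  forall (V : Type) (a : form L V) e,
  sat r (AC_relativize a : form (AC_sig L n) V) (j \o e) <-> sat rA a e.
Proof.
move=> j_inj jO jR V a; elim: a => {V} [V R v|V x y|V a IHa b IHb|V a IHa|V a IHa] e.
- by rewrite -[sat rA _ _]/(rA R (map_tuple e v)) -jR map_tuple_comp.
- by split=> [/j_inj|/(congr1 j)].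
- by split=> -[/IHa ? /IHb].
- by split=> h /IHa.
- rewrite [AC_relativize _]/= sat_AllS sat_All.
  have E x : j \o oapp e x = oapp (j \o e) (j x) by apply: funext; case.
  split=> [h x|h _ /jO[x ->]]; last by rewrite -E; apply/IHa.
  by apply/IHa; rewrite E; apply: h; apply/jO; exists x.
Qed.

Lemma models_AC (T : theory L) : models r (AC n T) <->
  [/\ models r (sort_axiom (AC_msig L n)),
      forall a, T a -> sat r (AC_relativize a : sentence (AC_sig L n)) (of_void M),
      forall k : 'I_n, exists2 X, isC k X &
        forall xs : k.+1.-tuple M, (forall i, isO (tnth xs i)) -> ~ mem_cls X xs &
      forall (k : 'I_n) X (xs : k.+1.-tuple M), isC k X -> (forall i, isO (tnth xs i)) ->
        exists2 Y, isC k Y & forall ys : k.+1.-tuple M, (forall i, isO (tnth ys i)) ->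
          mem_cls Y ys <-> mem_cls X ys \/ ys = xs].
Proof.
have memNE (k : 'I_n) X (xs : k.+1.-tuple M) :
    sat r (Mem (bvars k.+1) (wk k.+1 None) : form (AC_sig L n) _)
      (extenv (oapp (of_void M) X) xs) <-> mem_cls X xs.
  by rewrite sat_Mem extenv_bvars extenv_wk.
have adjE (k : 'I_n) X Y (xs ys : k.+1.-tuple M) :
   sat r (let X := wk k.+1 (Some (wk k.+1 None)) in
       let x := map_tuple (fun v => wk k.+1 (Some v)) (bvars k.+1) in
       let Y := wk k.+1 None in
       let y := bvars k.+1 in
       Iff (Mem y Y) (Or (Mem y X) (EqT y x)) : form (AC_sig L n) _)
     (extenv (oapp (extenv (oapp (of_void M) X) xs) Y) ys) <->
   (mem_cls Y ys <-> mem_cls X ys \/ ys = xs).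
  rewrite sat_Iff sat_Or !sat_Mem sat_EqT map_tuple_comp !extenv_bvars !extenv_wk /=.
  rewrite extenv_wk (_ : map_tuple _ _ = xs) // -[RHS](extenv_bvars (oapp (of_void M) X) xs).
  by congr map_tuple; apply: funext => v; rewrite /= extenv_wk.
split=> [h|[h1 h2 h3 h4] _ [a sa|a Ta|k|k]].
- split=> [a sa|a Ta|k|k X xs kX xsO].
  + exact/h/AC_sorts.
  + exact/h/AC_base.
  + have /sat_ExS[X kX /sat_AllsS hX] := h _ (AC_empty T k).
    by exists X => // xs /hX Xxs /memNE.
  + have /sat_AllS/(_ X kX)/sat_AllsS/(_ xs xsO)/sat_ExS[Y kY /sat_AllsS hY] := h _ (AC_adj T k).
    by exists Y => // ys /hY/adjE.
- exact: h1.
- exact: h2.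
- apply/sat_ExS; have [X kX hX] := h3 k; exists X => //.
  by apply/sat_AllsS => xs /hX Xxs /memNE.
- apply/sat_AllS => X kX; apply/sat_AllsS => xs xsO; apply/sat_ExS.
  have [Y kY hY] := h4 k X xs kX xsO; exists Y => //.
  by apply/sat_AllsS => ys /hY ?; apply/adjE.
Qed.

End ACModels.

(** * Models of adjunctive sets *)

Section ASModels.
Context {L : signature} {M : Type} (r : str (AS_sig L) M).

Definition mem_set (w x : M) : Prop := r (R := None : sym (AS_sig L)) [tuple w; x].

Lemma sat_In {V : Type} (x y : V) e :
  sat r (In x y : form (AS_sig L) V) e <-> mem_set (e x) (e y).
Proof.
rewrite /mem_set -[sat _ _ _]/(r (R := None : sym (AS_sig L)) (map_tuple e [tuple x; y])).
by rewrite (_ : map_tuple _ _ = [tuple e x; e y]) //; apply: val_inj.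
Qed.

Definition base_str : str L M := fun R v => r (R := Some R : sym (AS_sig L)) v.

Lemma sat_emb {V : Type} (a : form L V) e :
  sat r (AS_emb a) e <-> sat base_str a e.
Proof.
elim: a e => {V} [V R v|V x y|V a IHa b IHb|V a IHa|V a IHa] e //=.
- by rewrite IHa IHb.
- by rewrite IHa.
- by split=> h x; apply/IHa.
Qed.

Lemma models_AS (T : theory L) : models r (AS T) ->
  [/\ models base_str T, exists x, forall y, ~ mem_set y x &
      forall x y, exists z, forall w, mem_set w z <-> mem_set w x \/ w = y].
Proof.
move=> h; split.
- by move=> a /(AS_base (T := T))/h/sat_emb.
- have /sat_Ex[x hx] := h _ (AS_empty T); exists x => y hy.
  by apply: (hx y); apply: (sat_In None (Some None) (oapp (oapp (of_void M) x) y)).2.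
- move=> x y; have /sat_All/(_ x)/sat_All/(_ y)/sat_Ex[z /sat_All hz] := h _ (AS_adj T).
  exists z => w; move: (hz w) => /sat_Iff; rewrite sat_In sat_Or sat_In.
  exact.
Qed.

End ASModels.

(** * Adjunctive classes in adjunctive sets *)

Section ClassesFromSets.
Context {L : signature}.

Section Formulas.
Context {M : Type} (r : str (AS_sig L) M).
Local Notation "w \E x" := (mem_set r w x) (at level 50).

(* Separation for Russell's formula: a universal set is not small, while
   smallness survives adjunction. *)
Definition small x := exists z, forall w, w \E z <-> w \E x /\ ~ w \E w.

(** Extensionality is not assumed, so pairing is a relation: several sets may be the pair of the
    same [a] and [b]. *)
Definition upair p a b := forall w, w \E p <-> w = a \/ w = b.

Definition opair p a b := exists u v, [/\ upair u a a, upair v a b & upair p u v].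

(** The case [k == 0] is that of unary classes. A set that is not small codes the empty unary class,
    so that every set codes a class. *)
Definition mem_code (k : nat) (X : M) (x : 'I_k.+1 -> M) : Prop :=
  if k == 0 then small X /\ x ord0 \E X
  else exists p, p \E X /\ opair p (x ord0) (x ord_max).

(** Kuratowski's argument survives without extensionality because both pairs are the same set [p]: a
    member of [p] is identical with [u'] or [v']. *)
Lemma opair_inj p a b a' b' : opair p a b -> opair p a' b' -> a = a' /\ b = b'.
Proof.
move=> [u [v [ua vb puv]]] [u' [v' [ua' vb' puv']]].
have aa' : a = a'.
  have /puv'[uu'|uv'] : u \E p by apply/puv; left.
    by move: ua; rewrite uu' => /(_ a)[_ /(_ (or_introl erefl))]/ua'[].
  by move: ua; rewrite uv' => /(_ a')[/(_ _)]; case=> //; apply/vb'; left.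
subst a'; split=> //.
have in_u w : w \E u <-> w = a by split=> [/ua[]|->]; last by apply/ua; left.
have in_u' w : w \E u' <-> w = a by split=> [/ua'[]|->]; last by apply/ua'; left.
have bv : b \E v by apply/vb; right.
have bv' : b' \E v' by apply/vb'; right.
(* [v'] is either the singleton [u], in which case all entries equal [a], or it is [v]. *)
have /puv[v'u|v'v] : v' \E p by apply/puv'; right.
  have b'a : b' = a by apply/in_u; rewrite -v'u.
  have /puv'[vu'|vv'] : v \E p by apply/puv; right.
    by rewrite b'a; apply/in_u'; rewrite -vu'.
  by rewrite b'a; apply/in_u; rewrite -v'u -vv'.
move: bv'; rewrite v'v => /vb[b'a|//].
by move: bv; rewrite -v'v => /vb'[->|//].
Qed.

End Formulas.

(** A triple codes its last entry, and which of the first two entries equal it tells the sort. Of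
    the four patterns, three are for the objects and the two sorts of classes; the fourth, [point],
    is for the only world. *)
Definition kind {M : Type} (s : option 'I_2) (t : 'I_3 -> M) : Prop :=
  let a := t (inord 0) = t (inord 2) in let b := t (inord 1) = t (inord 2) in
  match s with
  | None => a /\ ~ b
  | Some k => if k == ord0 then ~ a /\ b else ~ a /\ ~ b
  end.

Definition point {M : Type} (t : 'I_3 -> M) : Prop :=
  t (inord 0) = t (inord 2) /\ t (inord 1) = t (inord 2).

Definition coded {M : Type} (t : 'I_3 -> M) (x : option 'I_2 * M) : Prop :=
  kind x.1 t /\ t (inord 2) = x.2.

Lemma kind_uniq {M : Type} s s' (t : 'I_3 -> M) : kind s t -> kind s' t -> s = s'.
Proof.
have ord2 (k : 'I_2) : k != ord0 -> k = ord_max.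
  by case: k => -[|[|//]] kP // _; apply: val_inj.
case: s s' => [k|] [k'|] /=; do ?case: (eqVneq k) => [->|/ord2->];
  do ?case: (eqVneq k') => [->|/ord2->]; tauto.
Qed.

Lemma not_point {M : Type} (t : 'I_3 -> M) : ~ point t <-> exists s, kind s t.
Proof.
rewrite /point; split=> [h|[[k|] /=]]; [|by case: ifP; tauto|tauto].
have [a|a] := pselect (t (inord 0) = t (inord 2)).
  by exists None; split=> // b; apply: h.
have [b|b] := pselect (t (inord 1) = t (inord 2)).
  by exists (Some ord0).
by exists (Some ord_max).
Qed.

Section ClassModel.
Context {M : Type} (r : str (AS_sig L) M) (m0 : M) (T : theory L).
Hypothesis rT : models r (AS T).
Local Notation "w \E x" := (mem_set r w x) (at level 50).
Local Notation N := (option 'I_2 * M)%type.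

(** The model consists of three tagged copies of the universe of sets, one for each sort. *)
Definition class_str : str (AC_sig L 2) N := fun R =>
  match R return (@ar (AC_sig L 2) R).-tuple N -> Prop with
  | inl s => fun v => (thead v).1 = s
  | inr (inl R) => fun v =>
      (forall i, (tnth v i).1 = None) /\ base_str r (map_tuple snd v)
  | inr (inr k) => fun v =>
      [/\ (tnth v ord0).1 = Some k, forall i, (tnth v (lift ord0 i)).1 = None &
          mem_code r (tnth v ord0).2 (fun i : 'I_k.+1 => (tnth v (lift ord0 i)).2)]
  end.

Lemma class_sortE s x : has_sort (M := AC_msig L 2) class_str s x <-> x.1 = s.
Proof. by []. Qed.

Lemma class_memE (k : 'I_2) X xs :
  isC class_str k X -> (forall i, isO class_str (tnth xs i)) ->
  mem_cls class_str X xs <-> mem_code r X.2 (fun i : 'I_k.+1 => (tnth xs i).2).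
Proof.
move=> kX xsO; have E : (fun i : 'I_k.+1 => (tnth (cons_tuple X xs) (lift ord0 i)).2) =
    (fun i : 'I_k.+1 => (tnth xs i).2) by apply: funext => i; rewrite tnthS.
rewrite /mem_cls /=; split=> [[_ _]|h]; first by rewrite E.
by split=> // [i|]; rewrite ?E // tnthS; apply: xsO.
Qed.

Lemma set_empty : exists x, forall y, ~ y \E x.
Proof. by have [] := models_AS rT. Qed.

Lemma set_adj x y : exists z, forall w, w \E z <-> w \E x \/ w = y.
Proof. by have [_ _ ] := models_AS rT; apply. Qed.

Lemma upair_ex a b : exists p, upair r p a b.
Proof.
have [e eP] := set_empty; have [u uP] := set_adj e a; have [p pP] := set_adj u b.
by exists p => w; rewrite pP uP; split=> [[[/eP|]|]|[|]]; tauto.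
Qed.

Lemma opair_ex a b : exists p, opair r p a b.
Proof.
have [u ua] := upair_ex a a; have [v vb] := upair_ex a b.
by have [p pP] := upair_ex u v; exists p, u, v.
Qed.

(** If [y] is a member of itself, the Russell part of [x] serves for [z] as well; otherwise [y] is
    adjoined to it. *)
Lemma small_adj x y z : small r x -> (forall w, w \E z <-> w \E x \/ w = y) -> small r z.
Proof.
move=> [s sP] zP; have [yy|nyy] := pselect (y \E y).
  exists s => w; rewrite sP zP; split=> [[]|[[] // -> //]]; tauto.
have [s' s'P] := set_adj s y; exists s' => w; rewrite s'P sP zP.
by split=> [[|->]|[[|]]]; tauto.
Qed.

(** Every pattern of equalities in [kind] must occur with a given last entry, which takes two
    elements: the empty set and its singleton are distinct. *)
Lemma other_ex (m : M) : exists n, n <> m.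
Proof.
have [e eP] := set_empty; have [s sP] := set_adj e e.
have [<-|] := pselect (e = m); last by exists e.
by exists s => se; apply: (eP e); rewrite -{2}se; apply/sP; right.
Qed.

Lemma class_model_AC : models class_str (AC 2 T).
Proof.
have [base _ _] := models_AS rT.
have [e eP] := set_empty.
have small_e : small r e by exists e => w; split=> [/eP|[/eP]].
apply/models_AC; split.
- apply/models_sort_axiom; split=> [s|x|s s' x ss' xs xs'|].
  + by exists (s, m0); apply/class_sortE.
  + by exists x.1; apply/class_sortE.
  + by case/eqP: ss'; transitivity x.1.
  + case=> [R|k] v i.
      by case=> h _; rewrite tnth_nseq; apply: h.
    case=> h0 h1 _; case: (unliftP ord0 i) => [j|] ->; last by rewrite tnth0.
    by rewrite tnthS tnth_nseq; apply: h1.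
- move=> a Ta; rewrite -(of_void_uniq ((fun x => (None, x)) \o of_void M)).
  apply/(sat_relativize (rA := base_str r)); last exact: base.
  + by move=> x y [].
  + case=> s x; split=> [sO|[y [-> _]]//]; exists x.
    by have -> : s = None := sO.
  + move=> R v; rewrite -[class_str _]/(_ /\ base_str r (map_tuple snd (map_tuple (pair None) v))).
    by rewrite map_tuple_comp map_tuple_id; split=> [[]|h] //; split=> // i; rewrite tnth_map.
- move=> k; exists (Some k, e) => // xs xsO; rewrite class_memE // /mem_code.
  by case: ifP => _ [] => [_ /eP|p [/eP]].
- move=> k [s X] xs sk xsO; have {sk} -> : s = Some k := sk.
  suff [Y YP] : exists Y, forall ys : 'I_k.+1 -> M,
      mem_code r Y ys <-> mem_code r X ys \/ ys = fun i => (tnth xs i).2.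
    exists (Some k, Y) => // ys ysO; rewrite !class_memE // YP /=.
    split=> -[|h]; [by left| |by left|by right; rewrite h].
    right; apply: eq_from_tnth => i; have := congr1 (@^~ i) h.
    have : (tnth xs i).1 = None := xsO i; have : (tnth ys i).1 = None := ysO i.
    by case: (tnth ys i) (tnth xs i) => [? ?] [? ?] /= -> -> ->.
  set x := fun i : 'I_k.+1 => (tnth xs i).2; rewrite /mem_code; case: (eqVneq (k : nat) 0) => k0.
    have ord10 (i : 'I_k.+1) : i = ord0 by apply: val_inj; case: i => -[|i] //=; rewrite k0.
    have xE (ys : 'I_k.+1 -> M) : ys = x <-> ys ord0 = x ord0.
      by split=> [->//|h]; apply: funext => i; rewrite (ord10 i).
    have [sX|nsX] := pselect (small r X).
      have [Y YP] := set_adj X (x ord0); have sY := small_adj sX YP.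
      by exists Y => ys; rewrite YP xE; tauto.
    (* Here [X] codes the empty class, so the adjunction is coded by a singleton. *)
    have [Y YP] := set_adj e (x ord0); have sY := small_adj small_e YP.
    by exists Y => ys; rewrite YP xE; have := eP (ys ord0); tauto.
  have k1 (i : 'I_k.+1) : i = ord0 \/ i = ord_max.
    case: k k0 {x xs xsO} i => -[|[|//]] kP // _ [[|[|//]] iP]; first by left; apply: val_inj.
    by right; apply: val_inj.
  have [p pP] := opair_ex (x ord0) (x ord_max).
  have [Y YP] := set_adj X p; exists Y => ys; split.
    move=> [q [/YP[qX|->] qP]]; first by left; exists q.
    (* The adjoined [p] codes no pair but [x]. *)
    have [h0 h1] := opair_inj qP pP.
    by right; apply: funext => i; case: (k1 i) => ->.
  move=> [[q [qX qP]]|->]; first by exists q; split=> //; apply/YP; left.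
  by exists p; split=> //; apply/YP; right.
Qed.

Lemma class_model_NU : sat class_str (NU : sentence (AC_sig L 2)) (of_void N).
Proof.
move=> /sat_ExS[X CX /sat_AllS XU].
have X_univ w : small r X.2 /\ w \E X.2.
  have /sat_Mem/class_memE := XU (None, w) erefl; apply=> //.
  by case=> -[|//] i.
(* [z] is the Russell set of a universal set. *)
have [z zP] := (X_univ m0).1.
by have := zP z; have := (X_univ z).2; tauto.
Qed.

End ClassModel.

(** The index [None] is that of the world. The sort of a block is read from [kind] and its value
    from entry 2. *)
Definition class_st (R : sym (AC_sig L 2)) :
    forall M : Type, str (AS_sig L) M -> (option 'I_(ar R) * 'I_3 -> M) -> Prop :=
  match R return forall M : Type, str (AS_sig L) M ->
    (option 'I_(@ar (AC_sig L 2) R) * 'I_3 -> M) -> Prop with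
  | inl s => fun M r e => kind s (fun c => e (Some ord0, c))
  | inr (inl R) => fun M r e =>
      (forall i, kind None (fun c => e (Some i, c))) /\
      base_str r (map_tuple e [tuple (Some i, inord 2) | i < ar R])
  | inr (inr k) => fun M r e =>
      [/\ kind (Some k) (fun c => e (Some ord0, c)),
          forall i : 'I_k.+1, kind None (fun c => e (Some (lift ord0 i), c)) &
          mem_code r (e (Some ord0, inord 2))
            (fun i : 'I_k.+1 => e (Some (lift ord0 i), inord 2))]
  end.

Lemma kind_def V s (f : 'I_3 -> V) :
  definable (fun M (_ : str (AS_sig L) M) e => kind s (fun c => e (f c))).
Proof.
by case: s => [k|]; rewrite /kind /=; first case: (k == ord0); definability.
Qed.

Lemma mem_set_def V (x y : V) :
  definable (fun M (r : str (AS_sig L) M) e => mem_set r (e x) (e y)).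
Proof. by exists (In x y) => M r e; rewrite sat_In. Qed.

Lemma mem_code_def V k X (f : 'I_k.+1 -> V) :
  definable (fun M (r : str (AS_sig L) M) e => mem_code r (e X) (fun i => e (f i))).
Proof.
rewrite /mem_code; case: (k == 0); definability; exact: mem_set_def.
Qed.

Lemma class_st_def R : definable (@class_st R).
Proof.
case: R => [s|[R|k]]; first exact: kind_def.
  apply: def_and; first by apply: def_all_ord => i; exact: kind_def.
  exact: def_rel.
apply: def_and3; [exact: kind_def| |exact: mem_code_def].
by apply: def_all_ord => i; exact: kind_def.
Qed.

Theorem AS_forcing_interprets_AC (T : theory L) :
  forcing_interprets (AS T) (plus (AC 2 T) NU).
Proof.
apply: (@forcing_interprets_def _ _ 3
  (fun M _ t => point t) (fun M _ t => ~ point t)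
  (* With a single world, equality and order of worlds are trivially true. *)
  (fun M _ e => e (true, ord0) = e (true, ord0))
  (* Triples name the same element when they have the same pattern and the same last entry. *)
  (fun M _ e =>
    ((e (true, inord 0) = e (true, inord 2) <-> e (false, inord 0) = e (false, inord 2)) /\
     (e (true, inord 1) = e (true, inord 2) <-> e (false, inord 1) = e (false, inord 2))) /\
    e (true, inord 2) = e (false, inord 2))
  (fun M _ e => e (true, ord0) = e (true, ord0)) class_st) => //.
- by rewrite /point; definability.
- by rewrite /point; definability.
- by definability.
- by definability.
- by definability.
- exact: class_st_def.
move=> M r m0 rT.
pose N := (option 'I_2 * M)%type.
have forcE V (a : form (AC_sig L 2) V) p e := @forc_const _ unit N V (fun _ _ => True)
  (class_str r) a p e (fun=> I).
exists unit, N, (fun _ _ => True), (fun R _ => @class_str _ r R), tt, (None, m0).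
split=> //.
- by move=> p R v /(_ p I)[].
- move=> a p Ua; apply/forcE; case: Ua => [/(class_model_AC m0 rT)//|->].
  exact: (class_model_NU m0).
exists (fun t _ => point t), (@coded M); split.
- split=> t; first by split=> [|[]//]; exists tt.
  rewrite not_point; split=> [[s st]|[[s m] [st _]]]; last by exists s.
  by exists (s, t (inord 2)).
- split=> [p|[s m]]; first by exists (fun=> m0).
  have [n nm] := other_ex rT m; pose t a b (c : 'I_3) := nth m [:: a; b; m] c.
  have tE a b : (t a b (inord 0) = a) * (t a b (inord 1) = b) * (t a b (inord 2) = m).
    by rewrite /t !inordK.
  case: s => [k|]; [case: (eqVneq k ord0) => [->|k0]|].
  + by exists (t n m); rewrite /coded /kind /= !tE.
  + by exists (t n n); rewrite /coded /kind /= (negPf k0) !tE.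
  + by exists (t m n); rewrite /coded /kind /= !tE.
- by move=> t pt npt; apply: npt.
- split=> [t t' [] [] _ _|t t' [s m] [s' m'] [st tm] [st' tm']]; first by split.
  rewrite /pair_env /=; split=> [[[h0 h1] h2]|[ss' mm']].
    have tt' u : kind u t <-> kind u t'.
      by case: u => [k|]; rewrite /kind /=; first case: (k == ord0); tauto.
    have E : s' = s := kind_uniq st' ((tt' s).1 st).
    congr (_, _); [exact: esym E|exact: etrans (esym tm) (etrans h2 tm')].
  subst s' m'; split; last exact: etrans tm (esym tm').
  move: st st'; rewrite /kind /=; case: (s) => [k|]; first case: (k == ord0); tauto.
move=> R t ts p xs tp tx.
have kindE i s : kind s (ts i) <-> (tnth xs i).1 = s.
  by split=> [/(kind_uniq (tx i).1)|<-]; [|case: (tx i)].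
case: R ts xs tx kindE => [s|[R|k]] ts xs tx kindE.
- exact: kindE.
- have E : map_tuple (fun oc => oapp ts t oc.1 oc.2) [tuple (Some i, inord 2) | i < ar R] =
      map_tuple snd xs.
    by apply: eq_from_tnth => i; rewrite !tnth_map tnth_ord_tuple; case: (tx i).
  rewrite -[class_st _ _]/((forall i, kind None (ts i)) /\ base_str r (map_tuple _ _)) E.
  by split=> -[h ?]; split=> // i; have := h i; rewrite kindE.
- have E : (fun i : 'I_k.+1 => ts (lift ord0 i) (inord 2)) =
      (fun i : 'I_k.+1 => (tnth xs (lift ord0 i)).2).
    by apply: funext => i; case: (tx (lift ord0 i)).
  have E0 : ts ord0 (inord 2) = (tnth xs ord0).2 by case: (tx ord0).
  rewrite -[class_st _ _]/([/\ kind (Some k) (ts ord0),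
    forall i : 'I_k.+1, kind None (ts (lift ord0 i)) &
    mem_code r (ts ord0 (inord 2)) (fun i : 'I_k.+1 => ts (lift ord0 i) (inord 2))]).
  rewrite E E0.
  by split=> -[h0 h ?]; split=> // [|i]; [exact/kindE|have := h i; rewrite kindE
    |exact/kindE|have := h i; rewrite kindE].
Qed.

End ClassesFromSets.

(** * Generic adjunctive sets over adjunctive classes *)

Section SetsFromClasses.
Context {L : signature}.
Local Notation c1 := (ord0 : 'I_2).
Local Notation c2 := (ord_max : 'I_2).

Section Formulas.
Context {M : Type} (r : str (AC_sig L 2) M).

Definition mem1 x A : Prop := mem_cls (k := c1) r A [tuple x].
Definition mem2 x y E : Prop := mem_cls (k := c2) r E [tuple x; y].

(* The column [{u | (u, x) in E}] can be put below any [c], next to any class.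
   Plain adjunction only adds one pair at a time. *)
Definition addible x E := forall F c, isC r c2 F -> isO r c ->
  exists G, isC r c2 G /\ forall u v, mem2 u v G <-> mem2 u v F \/ v = c /\ mem2 u x E.

Definition condition A E :=
  [/\ isC r c1 A, isC r c2 E, forall w x, mem2 w x E -> mem1 x A &
      forall x, isO r x -> addible x E].

(** Columns already decided are frozen: a stronger condition neither adds nor removes members of a
    set coded in [A]. *)
Definition extends A' E' A E :=
  forall x, mem1 x A -> mem1 x A' /\ forall w, mem2 w x E' <-> mem2 w x E.

End Formulas.

(** * The generic Kripke model over a model of adjunctive classes *)

Section GenericModel.
Context {M : Type} (r : str (AC_sig L 2) M) (T : theory L).
Hypothesis rT : models r (plus (AC 2 T) NU).

Definition object := {x : M | isO r x}.
Definition forcing_cond := {p : M * M | condition r p.1 p.2}.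
Implicit Types p q s : forcing_cond.
Local Notation dom p := (sval p).1.
Local Notation gen p := (sval p).2.

Definition stronger q p := extends r (dom q) (gen q) (dom p) (gen p).

Definition gen_str (R : sym (AS_sig L)) p : (ar R).-tuple object -> Prop :=
  match R return (@ar (AS_sig L) R).-tuple object -> Prop with
  | None => fun v => mem2 r (sval (thead v)) (sval (thead (behead_tuple v))) (gen p)
  | Some R => fun v => r (R := inr (inl R) : sym (AC_sig L 2)) (map_tuple sval v)
  end.

Let rAC : models r (AC 2 T). Proof. by move=> a Ta; apply: rT; left. Qed.

Lemma ord2P (i : 'I_2) : i = ord0 \/ i = ord_max.
Proof. by case: i => -[|[|//]] i; [left|right]; apply: val_inj. Qed.

Lemma mem1_obj x A : mem1 r x A -> isO r x.
Proof.
have [/models_sort_axiom[_ _ _ typ] _ _ _] := (models_AC r T).1 rAC.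
by move/(typ (inr c1) _ ord_max).
Qed.

Lemma mem2_obj x y E : mem2 r x y E -> isO r x /\ isO r y.
Proof.
have [/models_sort_axiom[_ _ _ typ] _ _ _] := (models_AC r T).1 rAC.
by move=> h; split; [move: h => /(typ (inr c2) _ (lift ord0 ord0))|move: h => /(typ (inr c2) _ ord_max)].
Qed.

Lemma C1_not_O A : isC r c1 A -> ~ isO r A.
Proof.
have [/models_sort_axiom[_ _ disj _] _ _ _] := (models_AC r T).1 rAC.
exact: disj.
Qed.

Lemma obj_ex : exists x, isO r x.
Proof.
have [/models_sort_axiom[h _ _ _] _ _ _] := (models_AC r T).1 rAC.
exact: h None.
Qed.

Lemma empty1 : exists A, isC r c1 A /\ forall x, ~ mem1 r x A.
Proof.
have [_ _ h _] := (models_AC r T).1 rAC; have [A CA hA] := h c1; exists A; split=> // x xA.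
by apply: hA (xA) => i; rewrite (ord1 i); apply: mem1_obj xA.
Qed.

Lemma empty2 : exists E, isC r c2 E /\ forall x y, ~ mem2 r x y E.
Proof.
have [_ _ h _] := (models_AC r T).1 rAC; have [A CA hA] := h c2; exists A; split=> // x y xyA.
by apply: hA (xyA) => i; case: (ord2P i) => ->; case: (mem2_obj xyA).
Qed.

Lemma adj1 A x : isC r c1 A -> isO r x ->
  exists B, isC r c1 B /\ forall u, mem1 r u B <-> mem1 r u A \/ u = x.
Proof.
move=> CA xO; have [_ _ _ h] := (models_AC r T).1 rAC.
have one u : isO r u -> forall i, isO r (tnth [tuple u] i).
  by move=> uO i; rewrite (ord1 i).
have [B CB BP] := h c1 A [tuple x] CA (one _ xO).
exists B; split=> // u; split=> [uB|].
  by have [|/(congr1 val)[->]] := (BP _ (one _ (mem1_obj uB))).1 uB; [left|right].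
case=> [uA|->]; last by apply/(BP _ (one _ xO)); right.
by apply/(BP _ (one _ (mem1_obj uA))); left.
Qed.

Lemma adj2 E x y : isC r c2 E -> isO r x -> isO r y ->
  exists F, isC r c2 F /\ forall u v, mem2 r u v F <-> mem2 r u v E \/ (u = x /\ v = y).
Proof.
move=> CE xO yO; have [_ _ _ h] := (models_AC r T).1 rAC.
have two u v : isO r u -> isO r v -> forall i, isO r (tnth [tuple u; v] i).
  by move=> uO vO i; case: (ord2P i) => ->.
have [F CF FP] := h c2 E [tuple x; y] CE (two _ _ xO yO).
exists F; split=> // u v; split=> [uvF|].
  have [uO vO] := mem2_obj uvF.
  by have [|/(congr1 val)[-> ->]] := (FP _ (two _ _ uO vO)).1 uvF; [left|right].
case=> [uvE|[-> ->]]; last by apply/(FP _ (two _ _ xO yO)); right.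
by have [uO vO] := mem2_obj uvE; apply/(FP _ (two _ _ uO vO)); left.
Qed.

Lemma fresh_ex A : isC r c1 A -> exists x, isO r x /\ ~ mem1 r x A.
Proof.
move=> CA; apply: contrapT => h; have := rT (or_intror erefl).
suff : sat r (ExS (cls c1) (AllS obj (Mem (k := c1) [tuple v0] v1)) : sentence (AC_sig L 2))
  (of_void M) by [].
apply/sat_ExS; exists A => //; apply/sat_AllS => x xO; apply/sat_Mem.
apply: contrapT => xA; apply: h; exists x; split=> // xA'; apply: xA.
by rewrite (_ : map_tuple _ _ = [tuple x]) //; apply: val_inj.
Qed.

Lemma stronger_refl p : stronger p p.
Proof. by []. Qed.

Arguments stronger_refl p : clear implicits.

Lemma stronger_trans p q s : stronger p q -> stronger q s -> stronger p s.
Proof.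
move=> pq qs x /qs[xq qsx]; have [xp pqx] := pq x xq.
by split=> // w; rewrite pqx qsx.
Qed.

Lemma cond_ex : exists p : forcing_cond, True.
Proof.
have [A [CA A0]] := empty1; have [E [CE E0]] := empty2.
have c : condition r A E.
  split=> // [w x /E0//|x xO F c CF cO]; exists F; split=> // u v.
  by split=> [|[|[_ /E0]]]; [left| |].
by exists (exist _ (A, E) c).
Qed.

(** Entering the domain without new pairs makes [x] an empty set if it was undecided. *)
Lemma extend_dom p (x : object) : exists q, [/\ stronger q p, mem1 r (sval x) (dom q) & gen q = gen p].
Proof.
case: p => -[A E] /= [CA CE EA Eadd]; case: x => x xO /=.
have [B [CB BP]] := adj1 CA xO.
have c : condition r B E by split=> // w y /EA yA; apply/BP; left.
exists (exist _ (B, E) c); split=> //; last by apply/BP; right.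
by move=> y yA; split=> //; apply/BP; left.
Qed.

Lemma extend_adj p (x y : object) : mem1 r (sval x) (dom p) ->
  exists q (z : object), [/\ stronger q p, mem1 r (sval z) (dom q) &
    forall w, mem2 r w (sval z) (gen q) <-> mem2 r w (sval x) (gen p) \/ w = sval y].
Proof.
case: p x y => -[A E] /= [CA CE EA Eadd] [x xO] [y yO] /= xA.
(* A fresh [z], whose column in [E] is empty, receives a copy of the column of [x] and the point
   [y]. *)
have [z [zO zA]] := fresh_ex CA; have [B [CB BP]] := adj1 CA zO.
have [F [CF FP]] := Eadd x xO E z CE zO; have [G [CG GP]] := adj2 CF yO zO.
have EzN w : ~ mem2 r w z E by move=> /EA.
have GE u v : mem2 r u v G <-> mem2 r u v E \/ v = z /\ (mem2 r u x E \/ u = y).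
  by rewrite GP FP; tauto.
have c : condition r B G.
  split=> // [w v /GE[/EA vA|[-> _]]|v vO H d CH dO]; [by apply/BP; left|by apply/BP; right|].
  have [->|vz] := pselect (v = z).
    (* The new column is that of [x] in [E] plus [y]: it is put below [d] by adding the old column
       and then the pair [(y, d)]. *)
    have [H1 [CH1 H1P]] := Eadd x xO H d CH dO; have [H2 [CH2 H2P]] := adj2 CH1 yO dO.
    exists H2; split=> // u w; rewrite H2P H1P GE.
    by have := EzN u; tauto.
  have [H1 [CH1 H1P]] := Eadd v vO H d CH dO; exists H1; split=> // u w.
  by rewrite H1P GE; tauto.
exists (exist _ (B, G) c), (exist _ z zO); split=> /=.
- move=> v vA; split=> [|w]; first by apply/BP; left.
  by rewrite GE; split=> [[//|[vz]]|]; [rewrite vz in vA|left].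
- by apply/BP; right.
- by move=> w; rewrite GE; have := EzN w; tauto.
Qed.

Lemma gen_mono p q R v : stronger q p -> gen_str (R := R) p v -> gen_str q v.
Proof.
case: R v => [//|] v qp /= h; have [_ _ EA _] := svalP p.
by apply/(qp _ (EA _ _ h)).2.
Qed.

(** An extension that decides the second argument with no new pair freezes its column, so a
    membership found below that extension already holds at [p]. *)
Lemma gen_dense p R v :
  (forall q, stronger q p -> exists2 s, stronger s q & gen_str (R := R) s v) -> gen_str p v.
Proof.
case: R v => [R|] v h; first by have [] := h p (stronger_refl p).
have [q [qp xq pq]] := extend_dom p (thead (behead_tuple v)).
have [s sq] := h q qp; rewrite /= -pq.
by move/((sq _ xq).2 _).
Qed.

Let forcing {V : Type} := @forc _ _ _ stronger gen_str V.

(** The predicates of [T] are the same at all conditions, so forcing is truth for them. *)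
Lemma gen_base V (a : form L V) p e : forcing (AS_emb a) p e <->
  sat (fun R v => gen_str (R := Some R) p v) a e.
Proof.
elim: a p e => {V} [V R v|V x y|V a IHa b IHb|V a IHa|V a IHa] p e //=.
- by rewrite IHa IHb.
- by split=> [/(_ p (stronger_refl p))|h q _]; rewrite IHa.
- by split=> [h x|h q _ x]; [apply/(IHa p)/(h p)|apply/IHa/h].
Qed.

Lemma gen_AS a p : AS T a -> forcing a p (of_void object).
Proof.
rewrite /forcing.
have All := @forc_All _ _ _ _ _ stronger_refl stronger_trans gen_mono.
have ExI := @forc_Ex _ _ _ _ gen_str stronger_refl stronger_trans.
have IffI := @forc_Iff _ _ _ _ _ stronger_refl stronger_trans gen_mono gen_dense.
have OrI := @forc_Or _ _ _ stronger gen_str.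
case=> [b Tb||].
- apply/gen_base; have [_ base _ _] := (models_AC r T).1 rAC.
  apply/(sat_relativize (r := r) (n := 2) (j := sval) _ _ _ b (of_void object)).
  + by move=> [x xO] [y yO] /= xy; apply: eq_exist.
  + by move=> x; split=> [xO|[[y yO] ->]//]; exists (exist _ x xO).
  + by [].
  + by rewrite (of_void_uniq (_ \o _)); apply: base.
(* A fresh [c] enters the domain with no members, and its column is frozen from then on. *)
- apply/ExI => q qp; case: (svalP q) => Cq _ _ _.
  have [c [cO cq]] := fresh_ex Cq.
  have [s [sq cs sqE]] := extend_dom q (exist _ c cO).
  exists s => //; exists (exist _ c cO); apply/All => y t ts.
  move=> /((ts _ cs).2 _); rewrite sqE => yc.
  by apply: cq; case: (svalP q) => _ _ + _; apply; exact: yc.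
- apply/All => x; apply/All => y; apply/ExI => q qp.
  (* Once [x] is decided its column is final and can be copied with [y] added. *)
  have [q1 [q1q xq1 _]] := extend_dom q x.
  have [s [z [sq1 zs sz]]] := extend_adj y xq1.
  exists s; first exact: stronger_trans sq1 q1q.
  exists z; apply/All => w; apply/IffI => t ts; rewrite OrI.
  have tz : mem2 r (sval w) (sval z) (gen t) <-> mem2 r (sval w) (sval x) (gen q1) \/ w = y.
    rewrite (ts _ zs).2 sz; split=> -[|wy]; [by left| |by left|by right; rewrite wy].
    right; case: (w) (y) wy => [? ?] [? ?] /= wy; exact: eq_exist.
  (* As columns are frozen, the disjunction has the same truth value at all conditions below [t]. *)
  have ux u : stronger u t -> mem2 r (sval w) (sval x) (gen u) <-> mem2 r (sval w) (sval x) (gen q1).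
    by move=> ut; apply: (stronger_trans ut (stronger_trans ts sq1) xq1).2.
  split=> [/tz h u ut|h]; first by exists u; [exact: stronger_refl|rewrite /= ux].
  by apply/tz; have [u ut] := h t (stronger_refl t); rewrite /= ux.
Qed.

End GenericModel.

(** A condition is named by the pair of its classes, an object by the pair with both entries equal
    to it. [None] is the index of the condition, whose entry [ord_max] is the binary class. *)
Definition gen_st (R : sym (AS_sig L)) :
    forall M : Type, str (AC_sig L 2) M -> (option 'I_(ar R) * 'I_2 -> M) -> Prop :=
  match R return forall M : Type, str (AC_sig L 2) M ->
    (option 'I_(@ar (AS_sig L) R) * 'I_2 -> M) -> Prop with
  | None => fun M r e =>
      mem2 r (e (Some ord0, ord0)) (e (Some ord_max, ord0)) (e (None, ord_max))
  | Some R => fun M r e => r (inr (inl R) : sym (AC_sig L 2))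
      (map_tuple e [tuple (Some i, ord0) | i < ar R])
  end.

Lemma has_sort_def V (s : srt (AC_msig L 2)) (x : V) :
  definable (fun M (r : str (AC_sig L 2) M) e => has_sort r s (e x)).
Proof. by exists (Srt s x) => M r e; apply: sat_Srt. Qed.

Lemma mem1_def V (x A : V) :
  definable (fun M (r : str (AC_sig L 2) M) e => mem1 r (e x) (e A)).
Proof.
exists (Mem (k := c1) [tuple x] A) => M r e; rewrite sat_Mem.
by rewrite (_ : map_tuple _ _ = [tuple e x]) //; apply: val_inj.
Qed.

Lemma mem2_def V (x y E : V) :
  definable (fun M (r : str (AC_sig L 2) M) e => mem2 r (e x) (e y) (e E)).
Proof.
exists (Mem (k := c2) [tuple x; y] E) => M r e; rewrite sat_Mem.
by rewrite (_ : map_tuple _ _ = [tuple e x; e y]) //; apply: val_inj.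
Qed.

Ltac ac_definability := rewrite /isO /isC; definability;
  first [exact: has_sort_def | exact: mem1_def | exact: mem2_def | idtac].

Lemma condition_def V (A E : V) :
  definable (fun M (r : str (AC_sig L 2) M) e => condition r (e A) (e E)).
Proof. by rewrite /condition /addible; ac_definability. Qed.

Lemma extends_def V (A' E' A E : V) :
  definable (fun M (r : str (AC_sig L 2) M) e => extends r (e A') (e E') (e A) (e E)).
Proof. by rewrite /extends; ac_definability. Qed.

Theorem AC_forcing_interprets_AS (T : theory L) :
  forcing_interprets (plus (AC 2 T) NU) (AS T).
Proof.
apply: (@forcing_interprets_def _ _ 2
  (fun M r t => condition r (t ord0) (t ord_max))
  (fun M r t => isO r (t ord0) /\ t ord0 = t ord_max)
  (fun M _ e => e (true, ord0) = e (false, ord0) /\ e (true, ord_max) = e (false, ord_max))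
  (fun M _ e => e (true, ord0) = e (false, ord0))
  (fun M r e => extends r (e (true, ord0)) (e (true, ord_max))
                  (e (false, ord0)) (e (false, ord_max))) gen_st) => //.
- exact: condition_def.
- by ac_definability.
- by definability.
- by definability.
- exact: extends_def.
- by case=> [R|]; [exact: def_rel|exact: mem2_def].
move=> M r m0 rT.
have [p0 _] := cond_ex rT; have [x xO] := obj_ex rT.
exists (forcing_cond r), (object r), (@stronger M r), (@gen_str M r), p0, (exist _ x xO).
split.
- by split=> [p|p q s]; [exact: stronger_refl|exact: stronger_trans].
- exact: gen_mono.
- exact: (gen_dense rT).
- by move=> a p; apply: gen_AS.
exists (fun t p => t ord0 = (sval p).1 /\ t ord_max = (sval p).2),
       (fun t y => t ord0 = sval y /\ t ord_max = sval y); split.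
- split=> t; split.
  + by move=> c; exists (exist _ (t ord0, t ord_max) c).
  + by move=> [[[A E] c] [-> ->]].
  + by move=> [tO t01]; exists (exist _ (t ord0) tO).
  + by move=> [[y yO] [-> ->]].
- split=> [p|y]; last by exists (fun=> sval y).
  by exists (fun c => if c == ord0 then (sval p).1 else (sval p).2).
(* No block names both a condition and an object, as its first entry would be a class and an
   object. *)
- by move=> t [CA _ _ _] [tO _]; apply: (C1_not_O rT CA).
- split=> [t t' p p' [tA tE] [tA' tE']|t t' y y' [ty _] [ty' _]].
    rewrite /pair_env /= tA tE tA' tE'; split=> //.
    case: p p' {tA tE tA' tE'} => [[A E] c] [[A' E'] c'] /=.
    by split=> [[AA' EE']|[-> ->]//]; apply: eq_exist; rewrite AA' EE'.
  rewrite /pair_env /= ty ty'; case: y y' {ty ty'} => [y yO] [y' yO'] /=.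
  by split=> [yy'|[]//]; apply: eq_exist.
- case=> [R|] t ts p xs [tA tE] tx.
    rewrite -[gen_st _ _]/(r (inr (inl R) : sym (AC_sig L 2)) (map_tuple _ _)).
    rewrite (_ : map_tuple _ _ = map_tuple sval xs); first exact: iff_refl.
    by apply: eq_from_tnth => i; rewrite !tnth_map tnth_ord_tuple; case: (tx i).
  rewrite -[gen_st _ _]/(mem2 r (ts ord0 ord0) (ts ord_max ord0) (t ord_max)) tE.
  have [-> _] := tx ord0; have [-> _] := tx ord_max.
  rewrite -[gen_str _ _]/(mem2 r (sval (thead xs)) (sval (thead (behead_tuple xs))) _).
  suff -> : thead (behead_tuple xs) = tnth xs ord_max by exact: iff_refl.
  by case/tupleP: xs {tx} => ? v; case/tupleP: v.
Qed.

End SetsFromClasses.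

Theorem theorem29 (L : signature) (T : theory L) :
  forcing_interprets (plus (AC 2 T) NU) (AS T) /\
  forcing_interprets (AS T) (plus (AC 2 T) NU).
Proof.
by split; [exact: AC_forcing_interprets_AS|exact: AS_forcing_interprets_AC].
Qed.
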